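(* Let $p \ge 2$ be an integer, let $f, g_1, \ldots, g_l, h_1, \ldots, h_m \colon \mathbb{R}^n \to \mathbb{R}$ be definable $C^p$-functions, and assume that $$S := \{x \in \mathbb{R}^n \mid g_1(x) \ge 0, \ldots, g_l(x) \ge 0,\ h_1(x) = 0, \ldots, h_m(x) = 0\} \ne \emptyset.$$ Assume that $f$ is non-negative on $S$ and let $x^* \in S$ be a zero of $f$ in $S$. If $S$ is regular at $x^*$ and the strict complementarity and second-order sufficiency conditions hold at $x^*$, then there are a definable open neighbourhood $U$ of $x^*$ and definable $C^{p-2}$-functions $\phi_i, \psi_j \colon U \to \mathbb{R}$ for $i = 0, \ldots, l$ and $j = 1, \ldots, m$, where each $\phi_i$ is a sum of squares of definable $C^{p-2}$-functions, such that on $U$ we have $$f = \phi_0 + \sum_{i=1}^l \phi_i g_i + \sum_{j=1}^m \psi_j h_j.$$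
   Context: An o-minimal structure on $(\mathbb{R}, +, \cdot)$ is a sequence $\mathcal{D} = (\mathcal{D}_n)_{n \in \mathbb{N}}$ such that for each $n$: (a) $\mathcal{D}_n$ is a Boolean algebra of subsets of $\mathbb{R}^n$; (b) if $X \in \mathcal{D}_m$ and $Y \in \mathcal{D}_n$ then $X \times Y \in \mathcal{D}_{m+n}$; (c) if $X \in \mathcal{D}_{n+1}$ then $\pi(X) \in \mathcal{D}_n$, where $\pi \colon \mathbb{R}^{n+1} \to \mathbb{R}^n$ is the projection on the first $n$ coordinates; (d) $\mathcal{D}_n$ contains all algebraic subsets of $\mathbb{R}^n$; (e) each set in $\mathcal{D}_1$ is a finite union of points and intervals. Fix an o-minimal structure on $(\mathbb{R}, +, \cdot)$; ''definable'' means belonging to this structure, and a mapping is definable if its graph is a definable set. ''Sum of squares'' means a finite sum of squares; the functions being squared have the same domain as $\phi_i$. For $x \in S$, let $I(x) := \{i \in \{1, \ldots, l\} \mid g_i(x) = 0\}$ (the active constraint indices). $S$ is regular at $x \in S$ if the gradient vectors $\nabla g_i(x)$, $i \in I(x)$, and $\nabla h_j(x)$, $j = 1, \ldots, m$, are linearly independent. If $x^*$ is a local minimizer of the restriction of $f$ to $S$ and $S$ is regular at $x^*$, there exist unique Lagrange multipliers $\lambda_1, \ldots, \lambda_l, \nu_1, \ldots, \nu_m \in \mathbb{R}$ satisfying the KKT optimality conditions $$\nabla f(x^* ) - \sum_{i=1}^l \lambda_i \nabla g_i(x^* ) - \sum_{j=1}^m \nu_j \nabla h_j(x^* ) = 0,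 \qquad \lambda_i g_i(x^* ) = 0,\ \lambda_i \ge 0 \ \text{ for } i = 1, \ldots, l.$$ (A zero in $S$ of a function $f$ that is non-negative on $S$ is such a minimizer.) With these multipliers: The strict complementarity condition holds at $x^*$ if $\lambda_i + g_i(x^* ) > 0$ for all $i = 1, \ldots, l$ (equivalently, $\lambda_i > 0$ for every $i \in I(x^* )$). Let $L(x) := f(x) - \sum_{i \in I(x^* )} \lambda_i g_i(x) - \sum_{j=1}^m \nu_j h_j(x)$ and $$T_{x^*}S := \{v \in \mathbb{R}^n \mid \langle v, \nabla g_i(x^* ) \rangle = 0 \text{ for } i \in I(x^* ), \ \langle v, \nabla h_j(x^* ) \rangle = 0 \text{ for } j = 1, \ldots, m\}.$$ The second-order sufficiency condition holds at $x^*$ if $v^T \nabla^2 L(x^* ) v > 0$ for all $v \in T_{x^*}S \setminus \{0\}$, where $\nabla^2 L(x^* )$ is the Hessian matrix of $L$ at $x^*$. *)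

(* Defs.v *)
From HB Require Import structures.
From mathcomp Require Import all_boot all_order all_algebra.
From mathcomp Require Import all_classical all_reals all_analysis.
(* the notations of mpoly clash with those of mathcomp-analysis *)
From mathcomp Require Import -(notations) mpoly.

Set Implicit Arguments.
Unset Strict Implicit.
Unset Printing Implicit Defensive.

Import Order.TTheory GRing.Theory Num.Theory.
Import numFieldNormedType.Exports.

Local Open Scope classical_set_scope.
Local Open Scope ring_scope.

Section Ominimal.
Variable R : realType.

Definition cylinder_product m n (X : set 'rV[R]_m) (Y : set 'rV[R]_n) :
    set 'rV[R]_(m + n) :=
  [set z | X (lsubmx z) /\ Y (rsubmx z)].

Definition algebraic_set n (X : set 'rV[R]_n) :=
  exists s : seq (mpoly n R),
    X = [set x | forall P, P \in s -> meval (fun i => x 0 i) P = 0].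

(* The library's [interval R] covers bounded and unbounded intervals, with
   open or closed ends. *)
Definition finite_union_points_intervals (X : set 'rV[R]_1) :=
  exists (s : seq R) (J : seq (interval R)),
    X = [set x | x 0 0 \in s \/ exists2 I, I \in J & x 0 0 \in I].

Record ominimal_structure (D : forall n, set (set 'rV[R]_n)) : Prop := {
  omin_set0 : forall n, D n set0;
  omin_setT : forall n, D n setT;
  omin_setU : forall n X Y, D n X -> D n Y -> D n (X `|` Y);
  omin_setI : forall n X Y, D n X -> D n Y -> D n (X `&` Y);
  omin_setC : forall n X, D n X -> D n (~` X);
  omin_prod : forall m n X Y,
    D m X -> D n Y -> D (m + n)%N (cylinder_product X Y);
  omin_proj : forall n (X : set 'rV[R]_(n + 1)),
    D (n + 1)%N X -> D n [set lsubmx z | z in X];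
  omin_alg : forall n X, algebraic_set X -> D n X;
  omin_dim1 : forall X, D 1%N X -> finite_union_points_intervals X
}.

(* A function U -> R is represented by a total function, of which only the
   values on U matter. *)
Definition definable_fun (D : forall n, set (set 'rV[R]_n)) n
    (U : set 'rV[R]_n) (f : 'rV[R]_n -> R) :=
  D (n + 1)%N [set z | U (lsubmx z) /\ rsubmx z 0 0 = f (lsubmx z)].

End Ominimal.

Section Calculus.
Variables (R : realType) (n : nat).
Implicit Types (U : set 'rV[R]_n) (f : 'rV[R]_n -> R) (x : 'rV[R]_n).

Definition partial (i : 'I_n) f : 'rV[R]_n -> R :=
  fun x => 'D_(delta_mx 0 i) f x.

(* C^k on the open set U: all partial derivatives of order at most k exist and
   are continuous on U. *)
Fixpoint Ck (k : nat) U f : Prop :=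
  {in U, continuous f} /\
  if k is k'.+1 then
    forall i : 'I_n, (forall x, U x -> derivable f x (delta_mx 0 i)) /\
                     Ck k' U (partial i f)
  else True.

Definition grad f x : 'rV[R]_n := \row_i partial i f x.

Definition hessian f x : 'M[R]_n := \matrix_(i, j) partial i (partial j f) x.

Definition definable_Ck (D : forall n, set (set 'rV[R]_n)) (k : nat) U f :=
  definable_fun D U f /\ Ck k U f.

Definition sum_of_squares_Ck (D : forall n, set (set 'rV[R]_n)) (k : nat) U f :=
  exists (N : nat) (q : 'I_N -> 'rV[R]_n -> R),
    (forall r, definable_Ck D k U (q r)) /\
    (forall x, U x -> f x = \sum_(r < N) q r x ^+ 2).

End Calculus.

Section Optimization.
Variables (R : realType) (n l m : nat).
Variables (f : 'rV[R]_n -> R) (g : 'I_l -> 'rV[R]_n -> R)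
          (h : 'I_m -> 'rV[R]_n -> R).
Implicit Types (x v : 'rV[R]_n) (lam : 'I_l -> R) (nu : 'I_m -> R).

Definition feasible_set : set 'rV[R]_n :=
  [set x | (forall i, 0 <= g i x) /\ (forall j, h j x = 0)].

Definition active x : pred 'I_l := [pred i | g i x == 0].

Definition regular_at x : bool :=
  free ([seq grad (g i) x | i in active x] ++ [seq grad (h j) x | j : 'I_m]).

Definition KKT x lam nu : Prop :=
  [/\ grad f x - \sum_i lam i *: grad (g i) x
        - \sum_j nu j *: grad (h j) x = 0,
      forall i, lam i * g i x = 0 &
      forall i, 0 <= lam i].

Definition lagrangian x lam nu : 'rV[R]_n -> R :=
  fun y => f y - \sum_(i | active x i) lam i * g i y - \sum_j nu j * h j y.

Definition tangent_space x : set 'rV[R]_n :=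
  [set v | (forall i, active x i -> v *m (grad (g i) x)^T = 0) /\
           (forall j, v *m (grad (h j) x)^T = 0)].

(* At a regular local minimizer the Lagrange multipliers exist and are unique;
   the universal quantifiers over lam and nu below refer to these, without
   making their existence part of the conditions. *)
Definition strict_complementarity x : Prop :=
  forall lam nu, KKT x lam nu -> forall i, 0 < lam i + g i x.

Definition second_order_sufficiency x : Prop :=
  forall lam nu, KKT x lam nu ->
  forall v, tangent_space x v -> v != 0 ->
    0 < (v *m hessian (lagrangian x lam nu) x *m v^T) 0 0.

End Optimization.

(* Main.v *)
Require Import Defs.
From HB Require Import structures.
From mathcomp Require Import all_boot all_order all_algebra.
From mathcomp Require Import all_classical all_reals all_analysis.
From mathcomp Require Import -(notations) mpoly.
From mathcomp Require Import ring lra.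

Set Implicit Arguments.
Unset Strict Implicit.
Unset Printing Implicit Defensive.

Import Order.TTheory GRing.Theory Num.Theory.
Import numFieldNormedType.Exports.

Local Open Scope classical_set_scope.
Local Open Scope ring_scope.

(** Let lam and nu be the Lagrange multipliers at xs and
    L = f - sum_(i active) lam_i g_i - sum_j nu_j h_j.  For every number N,

      f = (L + N (sum_(i active) g_i^2 + sum_j h_j^2))
          + sum_(i active) (lam_i - N g_i) g_i + sum_j (nu_j - N h_j) h_j.

    Strict complementarity makes lam_i - N g_i positive near xs for active i,
    hence the square of a C^p function.  The first bracket vanishes at xs
    together with its gradient, and its Hessian at xs is the Hessian of L plus
    2 N times the sum of the squares of the linear forms that cut out the
    tangent space.  As the Hessian of L is positive on that space, the total is
    positive definite once N is large ([finsler]).  A function with these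
    properties is locally a sum of squares
    ([local_sum_of_squares_of_hessian]), for two reasons.

    First, with y = x - xs, it has the form sum_(a,b) y_a y_b Q_ab(x) where the
    Q_ab are definable of class C^(p-2) ([definable_hadamard], applied
    twice).  Integrals of definable functions need not be definable, so Hadamard's
    lemma is applied one coordinate at a time: then the factors are difference
    quotients of the function in a single coordinate, which are definable, while
    the integral formula for the same factors gives their smoothness.

    Second, Q(xs) - (e/2) 1 is positive definite for a small e > 0, so that its
    form is a sum of squares of linear forms ([qform_sum_squares]), and the
    remaining (e/2) |y|^2 absorbs the small variable part E = Q - Q(xs) by
    completing a square in each product E_ab y_a y_b ([local_sum_of_squares]).

    The multipliers exist ([KKT_exists]) because the minimizers of a quadratic
    penalization of the problem on small balls around xs are stationary points
    ([penalized_stationary]); their normalized multipliers accumulate at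
    multipliers for xs, in which the coefficient of f does not vanish by
    regularity.

    Every function that occurs is definable on the whole space, and only the
    smoothness of the square roots needs the neighbourhood U, which is given by finitely many
    strict inequalities. *)

(** * Definable sets and functions *)

Section Definability.
Variables (R : realType) (D : forall n : nat, set (set 'rV[R]_n)).
Hypothesis hD : ominimal_structure D.

Local Notation dfun f := (definable_fun D setT f).

Lemma definable_iff n (X Y : set 'rV[R]_n) :
  (forall x, X x <-> Y x) -> D X -> D Y.
Proof. by move=> XY; have -> // : X = Y by apply/seteqP; split=> x /XY. Qed.

Lemma definable_not n (P : set 'rV[R]_n) : D P -> D [set x | ~ P x].
Proof. exact: omin_setC. Qed.

Lemma definable_and n (P Q : set 'rV[R]_n) :
  D P -> D Q -> D [set x | P x /\ Q x].
Proof. exact: omin_setI. Qed.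

Lemma definable_or n (P Q : set 'rV[R]_n) :
  D P -> D Q -> D [set x | P x \/ Q x].
Proof. exact: omin_setU. Qed.

Lemma definable_imp n (P Q : set 'rV[R]_n) :
  D P -> D Q -> D [set x | P x -> Q x].
Proof.
move=> DP DQ; apply: definable_iff (definable_or (definable_not DP) DQ) => x /=.
by split=> [[]//|PQ]; have [Px|] := pselect (P x); [right; exact: PQ|left].
Qed.

Lemma definable_all n (T : finType) (P : T -> set 'rV[R]_n) :
  (forall t, D (P t)) -> D [set x | forall t, P t x].
Proof.
move=> DP.
have DPs (s : seq T) : D [set x | forall t, t \in s -> P t x].
  elim: s => [|t s IH].
    by apply: definable_iff (omin_setT hD n) => x /=; split.
  apply: definable_iff (definable_and (DP t) IH) => x /=; split=> [[Pt Ps] u|Ps].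
    by rewrite inE => /predU1P[->|/Ps].
  by split=> [|u us]; apply: Ps; rewrite inE ?eqxx// us orbT.
apply: definable_iff (DPs (enum T)) => x /=.
by split=> Px t; [apply: Px; rewrite mem_enum|move=> _; exact: Px].
Qed.

Lemma definable_exists n (P : 'rV[R]_n -> R -> Prop) :
  D [set z : 'rV[R]_(n + 1) | P (lsubmx z) (rsubmx z 0 0)] ->
  D [set x | exists t, P x t].
Proof.
move=> /(omin_proj hD); apply: definable_iff => x /=; split.
  by move=> [z Pz <-]; exists (rsubmx z 0 0).
move=> [t Pt]; exists (row_mx x (const_mx t)); rewrite row_mxKl //.
by rewrite row_mxKr mxE.
Qed.

Lemma definable_forall n (P : 'rV[R]_n -> R -> Prop) :
  D [set z : 'rV[R]_(n + 1) | P (lsubmx z) (rsubmx z 0 0)] ->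
  D [set x | forall t, P x t].
Proof.
move=> DP.
have := definable_not (definable_exists (P := fun x t => ~ P x t)
  (definable_not DP)).
apply: definable_iff => x /=; split=> [nex t|Px [t]]; last exact.
by apply: contrapT => nP; apply: nex; exists t.
Qed.

Lemma definable_cast n n' (e : n = n') (X : set 'rV[R]_n') :
  D X -> D [set z : 'rV[R]_n | X (castmx (erefl, e) z)].
Proof. by case: n' / e X => X; under eq_set do rewrite castmx_id. Qed.

(** The projection axiom eliminates one variable at a time; the induction is on
    the number of variables, and the casts reassociate the dimension. *)
Lemma definable_exists_rV n m (P : 'rV[R]_n -> 'rV[R]_m -> Prop) :
  D [set z : 'rV[R]_(n + m) | P (lsubmx z) (rsubmx z)] ->
  D [set x | exists w, P x w].
Proof.
elim: m P => [|m IH] P DP.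
  have := definable_cast (esym (addn0 n)) DP; apply: definable_iff => x /=.
  have -> : lsubmx (castmx (erefl, esym (addn0 n)) x) = x.
    apply/rowP => i; rewrite mxE castmxE cast_ord_id; congr (x _ _).
    exact: val_inj.
  split=> [Px|[w Pw]]; first by eexists; exact: Px.
  by rewrite (_ : rsubmx _ = w)//; apply/rowP => -[].
have e : (n + m + 1 = n + m.+1)%N by rewrite addn1 addnS.
pose P' (x : 'rV[R]_n) (w : 'rV[R]_m) :=
  exists t : R, P x (castmx (erefl, addn1 m) (row_mx w (const_mx t))).
apply: (@definable_iff _ [set x | exists w, P' x w]).
  move=> x; split=> [[w [t Pt]]|[w Pw]]; first by eexists; exact: Pt.
  exists (lsubmx (castmx (erefl, esym (addn1 m)) w)).
  exists (rsubmx (castmx (erefl, esym (addn1 m)) w) 0 0).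
  rewrite (_ : const_mx _ = rsubmx (castmx (erefl, esym (addn1 m)) w)).
    by rewrite hsubmxK castmx_comp castmx_id.
  by apply/rowP => i; rewrite !mxE !ord1.
apply: IH; apply: definable_exists.
apply: definable_iff (definable_cast e DP) => z /=.
have -> : lsubmx (castmx (erefl, e) z) = lsubmx (lsubmx z).
  apply/rowP => i; rewrite !mxE castmxE cast_ord_id; congr (z _ _).
  exact: val_inj.
suff -> : rsubmx (castmx (erefl, e) z) = castmx (erefl, addn1 m)
  (row_mx (rsubmx (lsubmx z)) (const_mx (rsubmx z 0 0))) by [].
apply/rowP => i; rewrite !(mxE, castmxE) !cast_ord_id.
case: splitP => j; rewrite !mxE => /= ij; congr (z _ _); apply: val_inj => /=.
  by rewrite ij.
by rewrite ij ord1 !addn0.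
Qed.

Lemma definable_mpoly0 n (P : mpoly n R) :
  D [set x : 'rV[R]_n | meval (fun i => x 0 i) P = 0].
Proof.
apply: omin_alg => //; exists [:: P]; apply/seteqP; split=> x /= Px.
  by move=> Q; rewrite inE => /eqP ->.
by apply: Px; rewrite inE.
Qed.

Lemma definable_coord_eq n (i j : 'I_n) : D [set x : 'rV[R]_n | x 0 i = x 0 j].
Proof.
apply: definable_iff (definable_mpoly0 (mpolyX R (mnm1 i) - mpolyX R (mnm1 j))).
move=> x /=; rewrite mevalB !mevalXU.
by split=> [/eqP|->]; rewrite ?subr_eq0 ?subrr// => /eqP.
Qed.

Lemma definable_lsub m n (X : set 'rV[R]_m) :
  D X -> D [set z : 'rV[R]_(m + n) | X (lsubmx z)].
Proof.
move=> DX; apply: definable_iff (omin_prod hD DX (omin_setT hD n)) => z.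
by split=> [[]|Xz] //; split.
Qed.

Lemma definable_rsub m n (X : set 'rV[R]_n) :
  D X -> D [set z : 'rV[R]_(m + n) | X (rsubmx z)].
Proof.
move=> DX; apply: definable_iff (omin_prod hD (omin_setT hD m) DX) => z.
by split=> [[]|Xz] //; split.
Qed.

(** The pull-back of X is the projection of the set of pairs (x, w) with w in X
    and w_i = x_(s i), where the equations are algebraic. *)
Lemma definable_reindex m n (s : 'I_m -> 'I_n) (X : set 'rV[R]_m) :
  D X -> D [set x : 'rV[R]_n | X (\row_i x 0 (s i))].
Proof.
move=> DX; pose P (x : 'rV[R]_n) (w : 'rV[R]_m) :=
  X w /\ forall i, w 0 i = x 0 (s i).
apply: (@definable_iff _ [set x | exists w, P x w]) => [x /=|].
  split=> [[w [Xw wx]]|Xs]; last first.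
    by exists (\row_i x 0 (s i)); split=> [|i] //; rewrite mxE.
  by rewrite (_ : \row__ _ = w)//; apply/rowP => i; rewrite mxE wx.
apply: definable_exists_rV; apply: definable_and.
  exact: definable_rsub.
apply: definable_all => i.
apply: definable_iff (definable_coord_eq (rshift n i) (lshift m (s i))) => z /=.
by rewrite !mxE.
Qed.

Lemma definable_graph n (f : 'rV[R]_n -> R) :
  dfun f <-> D [set z : 'rV[R]_(n + 1) | rsubmx z 0 0 = f (lsubmx z)].
Proof.
by split; apply: definable_iff => z /=; [split=> [[]|zf]|split=> [zf|[]]].
Qed.

Lemma definable_preimage m n (psi : 'I_m -> 'rV[R]_n -> R) (X : set 'rV[R]_m) :
  (forall i, dfun (psi i)) -> D X -> D [set x | X (\row_i psi i x)].
Proof.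
move=> dpsi DX; pose P (x : 'rV[R]_n) (w : 'rV[R]_m) :=
  X w /\ forall i, w 0 i = psi i x.
apply: (@definable_iff _ [set x | exists w, P x w]) => [x /=|].
  split=> [[w [Xw wx]]|Xs]; last first.
    by exists (\row_i psi i x); split=> [|i] //; rewrite mxE.
  by rewrite (_ : \row__ _ = w)//; apply/rowP => i; rewrite mxE wx.
apply: definable_exists_rV; apply: definable_and.
  exact: definable_rsub.
apply: definable_all => i.
pose s (k : 'I_(n + 1)) : 'I_(n + m) :=
  match fintype.split k with inl j => lshift m j | inr _ => rshift n i end.
have /definable_graph/(definable_reindex s) := dpsi i.
apply: definable_iff => z /=.
have -> : lsubmx (\row_k z 0 (s k)) = lsubmx z.
  by apply/rowP => j; rewrite !mxE /s (unsplitK (inl j)).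
by rewrite !mxE /s (unsplitK (inr 0)).
Qed.

Lemma definable_coord n (i : 'I_n) : dfun (fun x => x 0 i).
Proof.
apply/definable_graph.
apply: definable_iff (definable_coord_eq (rshift n 0) (lshift 1 i)) => z /=.
by rewrite !mxE.
Qed.

Lemma definable_cst n (c : R) : dfun (fun _ : 'rV[R]_n => c).
Proof.
apply/definable_graph.
apply: definable_iff (definable_mpoly0 (mpolyX R (mnm1 (rshift n 0)) - mpolyC _ c)).
move=> x /=; rewrite mevalB mevalXU mevalC !mxE.
by split=> [/eqP|->]; rewrite ?subr_eq0 ?subrr// => /eqP.
Qed.

Lemma definable_lsubmx n k (f : 'rV[R]_n -> R) :
  dfun f -> dfun (fun z : 'rV[R]_(n + k) => f (lsubmx z)).
Proof.
move=> /definable_graph df; apply/definable_graph.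
pose s (j : 'I_(n + 1)) : 'I_(n + k + 1) :=
  match fintype.split j with inl j => lshift 1 (lshift k j) | inr _ => rshift (n + k) 0 end.
have := definable_reindex s df; apply: definable_iff => z /=.
have -> : lsubmx (\row_j z 0 (s j)) = lsubmx (lsubmx z).
  by apply/rowP => j; rewrite !mxE /s (unsplitK (inl j)).
by rewrite !mxE /s (unsplitK (inr 0)).
Qed.

Lemma definable_comp m n (f : 'rV[R]_m -> R) (psi : 'I_m -> 'rV[R]_n -> R) :
  dfun f -> (forall i, dfun (psi i)) -> dfun (fun x => f (\row_i psi i x)).
Proof.
move=> /definable_graph df dpsi; apply/definable_graph.
pose Psi (k : 'I_(m + 1)) (z : 'rV[R]_(n + 1)) :=
  match fintype.split k with inl i => psi i (lsubmx z) | inr _ => z 0 (rshift n 0) end.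
have dPsi k : dfun (Psi k).
  rewrite /Psi; case: (fintype.split k) => [i|_]; first exact: definable_lsubmx.
  exact: definable_coord.
have := definable_preimage dPsi df; apply: definable_iff => z /=.
have -> : lsubmx (\row_k Psi k z) = \row_i psi i (lsubmx z).
  by apply/rowP => j; rewrite !mxE /Psi (unsplitK (inl j)).
by rewrite !mxE /Psi (unsplitK (inr 0)).
Qed.

Lemma definable_comp_row m n (f : 'rV[R]_m -> R) (psi : 'rV[R]_n -> 'rV[R]_m) :
  dfun f -> (forall i, dfun (fun x => psi x 0 i)) -> dfun (fun x => f (psi x)).
Proof.
move=> df dpsi; have := definable_comp df dpsi.
by rewrite (_ : (fun x => f (\row_i psi x 0 i)) = fun x => f (psi x))//;
  apply/funext => x; congr f; apply/rowP => i; rewrite mxE.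
Qed.

Lemma definable_comp1 n (op : R -> R) (f : 'rV[R]_n -> R) :
  dfun (fun w : 'rV[R]_1 => op (w 0 0)) -> dfun f -> dfun (fun x => op (f x)).
Proof.
move=> dop df; have := @definable_comp_row _ _ _ (fun x => const_mx (f x)) dop.
under eq_fun do rewrite mxE; apply=> i.
by under eq_fun do rewrite mxE.
Qed.

Lemma definable_comp2 n (op : R -> R -> R) (f g : 'rV[R]_n -> R) :
  dfun (fun w : 'rV[R]_2 => op (w 0 0) (w 0 1)) -> dfun f -> dfun g ->
  dfun (fun x => op (f x) (g x)).
Proof.
move=> dop df dg.
have := @definable_comp_row _ _ _ (fun x => \row_i (if i == 0 then f x else g x)) dop.
under eq_fun do rewrite !mxE /=; apply=> i.
by under eq_fun do rewrite mxE; case: (i == 0).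
Qed.

Lemma definable_add n (f g : 'rV[R]_n -> R) :
  dfun f -> dfun g -> dfun (fun x => f x + g x).
Proof.
apply: definable_comp2; apply/definable_graph.
have := definable_mpoly0 (mpolyX R (mnm1 (rshift 2 (0 : 'I_1)))
  - (mpolyX R (mnm1 (lshift 1 (0 : 'I_2))) + mpolyX R (mnm1 (lshift 1 (1 : 'I_2))))).
apply: definable_iff => x /=; rewrite mevalB mevalD !mevalXU !mxE.
by split=> [/eqP|->]; rewrite ?subr_eq0 ?subrr// => /eqP.
Qed.

Lemma definable_mul n (f g : 'rV[R]_n -> R) :
  dfun f -> dfun g -> dfun (fun x => f x * g x).
Proof.
apply: definable_comp2; apply/definable_graph.
have := definable_mpoly0 (mpolyX R (mnm1 (rshift 2 (0 : 'I_1)))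
  - (mpolyX R (mnm1 (lshift 1 (0 : 'I_2))) * mpolyX R (mnm1 (lshift 1 (1 : 'I_2))))).
apply: definable_iff => x /=; rewrite mevalB mevalM !mevalXU !mxE.
by split=> [/eqP|->]; rewrite ?subr_eq0 ?subrr// => /eqP.
Qed.

Lemma definable_opp n (f : 'rV[R]_n -> R) : dfun f -> dfun (fun x => - f x).
Proof.
move=> df; have := definable_mul (definable_cst n (-1)) df.
by under eq_fun do rewrite mulN1r.
Qed.

Lemma definable_sub n (f g : 'rV[R]_n -> R) :
  dfun f -> dfun g -> dfun (fun x => f x - g x).
Proof. by move=> df dg; apply: definable_add => //; exact: definable_opp. Qed.

Lemma definable_sum n (I : Type) (s : seq I) (P : pred I) (f : I -> 'rV[R]_n -> R) :
  (forall i, P i -> dfun (f i)) -> dfun (fun x => \sum_(i <- s | P i) f i x).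
Proof.
move=> df; elim: s => [|i s IH].
  by under eq_fun do rewrite big_nil; exact: definable_cst.
under eq_fun do rewrite big_cons; have [/df dfi|//] := boolP (P i).
exact: definable_add.
Qed.

Lemma definable_eq n (f g : 'rV[R]_n -> R) :
  dfun f -> dfun g -> D [set x | f x = g x].
Proof.
move=> df dg.
have /(definable_exists (P := fun x t => t = f x /\ t = g x)) :=
  definable_and (proj1 (definable_graph f) df) (proj1 (definable_graph g) dg).
by apply: definable_iff => x /=; split=> [[t [-> ->]]//|fg]; exists (f x).
Qed.

(** The order is recovered from squares: a > 0 says that a s^2 = 1 for some s. *)
Lemma definable_lt n (f g : 'rV[R]_n -> R) :
  dfun f -> dfun g -> D [set x | f x < g x].
Proof.
move=> df dg.
pose P (x : 'rV[R]_n) t := (g x - f x) * (t * t) = 1.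
apply: (@definable_iff _ [set x | exists t, P x t]) => [x /=|].
  rewrite /P -subr_gt0; set a := g x - f x; split=> [[t at1]|a0].
    have : 0 < a * (t * t) by rewrite at1.
    have [->|t0] := eqVneq t 0; first by rewrite !mulr0 ltxx.
    by rewrite pmulr_lgt0// -expr2 exprn_even_gt0.
  exists (Num.sqrt a)^-1; rewrite -expr2 exprVn sqr_sqrtr ?divff// ?lt0r_neq0//.
  exact: ltW.
apply: definable_exists; apply: definable_eq; last exact: definable_cst.
apply: definable_mul.
  by apply: definable_sub; apply: definable_lsubmx.
have dt : dfun (fun z : 'rV[R]_(n + 1) => rsubmx z 0 0).
  by under eq_fun do rewrite mxE; exact: definable_coord.
exact: definable_mul.
Qed.

Lemma definable_le n (f g : 'rV[R]_n -> R) :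
  dfun f -> dfun g -> D [set x | f x <= g x].
Proof.
move=> df dg; apply: definable_iff (definable_not (definable_lt dg df)) => x /=.
by rewrite leNgt; split=> [/negP|/negP].
Qed.

Lemma definable_if n (P : 'rV[R]_n -> bool) (f g : 'rV[R]_n -> R) :
  D [set x | P x] -> dfun f -> dfun g -> dfun (fun x => if P x then f x else g x).
Proof.
move=> DP /definable_graph df /definable_graph dg; apply/definable_graph.
have DP1 : D [set z : 'rV[R]_(n + 1) | P (lsubmx z)].
  exact: definable_lsub DP.
have := definable_and (definable_imp DP1 df) (definable_imp (definable_not DP1) dg).
apply: definable_iff => z /=.
case: (P (lsubmx z)); split=> [[h1 h2]|h]; do ?[exact: h1|exact: h2|by split].
Qed.

Lemma definable_inv n (f : 'rV[R]_n -> R) : dfun f -> dfun (fun x => (f x)^-1).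
Proof.
apply: definable_comp1; apply/definable_graph.
have dl : dfun (fun z : 'rV[R]_(1 + 1) => lsubmx z 0 0).
  by under eq_fun do rewrite mxE; exact: definable_coord.
have dr : dfun (fun z : 'rV[R]_(1 + 1) => rsubmx z 0 0).
  by under eq_fun do rewrite mxE; exact: definable_coord.
have := definable_or (definable_eq (definable_mul dl dr) (definable_cst _ 1))
  (definable_and (definable_eq dl (definable_cst _ 0))
                 (definable_eq dr (definable_cst _ 0))).
apply: definable_iff => z /=; set a := lsubmx z 0 0; set b := rsubmx z 0 0.
split=> [[ab|[-> ->]]|->]; rewrite ?invr0//.
  have a0 : a != 0 by apply: contra_eq_neq ab => ->; rewrite mul0r eq_sym oner_eq0.
  by rewrite -[b](mulKf a0) ab mulr1.
by have [->|a0] := eqVneq a 0; [right; rewrite invr0|left; rewrite divff].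
Qed.

Lemma definable_sqrt n (f : 'rV[R]_n -> R) :
  dfun f -> dfun (fun x => Num.sqrt (f x)).
Proof.
apply: definable_comp1; apply/definable_graph.
have dl : dfun (fun z : 'rV[R]_(1 + 1) => lsubmx z 0 0).
  by under eq_fun do rewrite mxE; exact: definable_coord.
have dr : dfun (fun z : 'rV[R]_(1 + 1) => rsubmx z 0 0).
  by under eq_fun do rewrite mxE; exact: definable_coord.
have := definable_or
  (definable_and (definable_le (definable_cst _ 0) dr)
                 (definable_eq (definable_mul dr dr) dl))
  (definable_and (definable_lt dl (definable_cst _ 0))
                 (definable_eq dr (definable_cst _ 0))).
apply: definable_iff => z /=; set a := lsubmx z 0 0; set b := rsubmx z 0 0.
split=> [[[b0 <-]|[a0 ->]]|->].
- by rewrite -expr2 sqrtr_sqr ger0_norm.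
- by rewrite ler0_sqrtr// ltW.
have [a0|a0] := leP 0 a; first by left; rewrite sqrtr_ge0 -expr2 sqr_sqrtr.
by right; split=> //; rewrite ler0_sqrtr// ltW.
Qed.

Lemma definable_funW n (U : set 'rV[R]_n) (f : 'rV[R]_n -> R) :
  D U -> dfun f -> definable_fun D U f.
Proof.
move=> DU /definable_graph df.
exact: definable_and (definable_lsub 1 DU) df.
Qed.

(** A partial derivative is a limit of difference quotients, and the epsilon-delta
    definition of that limit is a first-order formula over the graph. *)
Lemma definable_partial n (f : 'rV[R]_n -> R) (i : 'I_n) :
  dfun f -> (forall x, derivable f x (delta_mx 0 i)) -> dfun (partial i f).
Proof.
move=> df fi; apply/definable_graph.
(* The condition on s is written s^2 < d, which needs no absolute value. *)
pose Q (z : 'rV[R]_(n + 1)) (e d s : R) :=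
  s * s < d -> s != 0 ->
  (f (s *: delta_mx 0 i + lsubmx z) - f (lsubmx z)) * s^-1 - rsubmx z 0 0 < e /\
  rsubmx z 0 0 - (f (s *: delta_mx 0 i + lsubmx z) - f (lsubmx z)) * s^-1 < e.
apply: (@definable_iff _ [set z | forall e, 0 < e -> exists d, 0 < d /\
  forall s, Q z e d s]).
  move=> z /=; set x := lsubmx z; set c := rsubmx z 0 0.
  have lim_iff : (forall e, 0 < e -> exists d, 0 < d /\ forall s, Q z e d s) <->
      (fun s => s^-1 *: ((f \o shift x) (s *: delta_mx 0 i) - f x)) @ 0^' --> c.
    split=> [H|/cvgrPdist_lt H].
      apply/cvgrPdist_lt => e /H[d [d0 Qd]].
      near=> s; have s0 : s != 0 by near: s; exact: nbhs_dnbhs_neq.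
      have sd : s * s < d.
        have : `|s| < Num.sqrt d.
          by near: s; apply: dnbhs0_lt; rewrite sqrtr_gt0.
        move=> sd; rewrite -expr2 -real_normK ?num_real// -(sqr_sqrtr (ltW d0)).
        by rewrite ltr_pXn2r// nnegrE ?sqrtr_ge0.
      have [h1 h2] := Qd s sd s0.
      rewrite ltr_norml /= [_ *: _]mulrC; apply/andP; split; last exact: h2.
      by rewrite ltrNl opprB; exact: h1.
    move=> e /H /nbhs_ballP[d /= d0 Hd]; exists (d ^+ 2); split.
      by rewrite exprn_gt0.
    move=> s sd s0.
    have /Hd : ball 0 d s.
      rewrite /ball /= sub0r normrN -(@ltr_pXn2r _ 2)// ?nnegrE ?(ltW d0)//.
      by rewrite real_normK ?num_real// expr2.
    move=> /(_ s0); rewrite /= [_ *: _]mulrC ltr_norml => /andP[h1 h2].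
    by split; [rewrite ltrNl opprB in h1; exact: h1|exact: h2].
  split=> [/lim_iff H|cE]; first by apply/esym/cvg_lim.
  by apply/lim_iff; rewrite cE; exact: fi.
have dr N : dfun (fun z : 'rV[R]_(N + 1) => rsubmx z 0 0).
  by under eq_fun do rewrite mxE; exact: definable_coord.
apply: definable_forall; apply: definable_imp.
  by apply: definable_lt => //; exact: definable_cst.
apply: definable_exists; apply: definable_and.
  by apply: definable_lt => //; exact: definable_cst.
apply: definable_forall; rewrite /Q.
have L1 N (h : 'rV[R]_N -> R) : dfun h ->
    dfun (fun z : 'rV[R]_(N + 1) => h (lsubmx z)) by exact: definable_lsubmx.
have dfx : dfun (fun z : 'rV[R]_(n + 1 + 1 + 1 + 1) =>
    f (lsubmx (lsubmx (lsubmx (lsubmx z))))) := L1 _ _ (L1 _ _ (L1 _ _ (L1 _ _ df))).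
have dx j : dfun (fun z : 'rV[R]_(n + 1 + 1 + 1 + 1) =>
    (lsubmx (lsubmx (lsubmx (lsubmx z)))) 0 j) :=
  L1 _ _ (L1 _ _ (L1 _ _ (L1 _ _ (definable_coord j)))).
have dc : dfun (fun z : 'rV[R]_(n + 1 + 1 + 1 + 1) =>
    rsubmx (lsubmx (lsubmx (lsubmx z))) 0 0) := L1 _ _ (L1 _ _ (L1 _ _ (dr _))).
have de : dfun (fun z : 'rV[R]_(n + 1 + 1 + 1 + 1) =>
    rsubmx (lsubmx (lsubmx z)) 0 0) := L1 _ _ (L1 _ _ (dr _)).
have dd : dfun (fun z : 'rV[R]_(n + 1 + 1 + 1 + 1) =>
    rsubmx (lsubmx z) 0 0) := L1 _ _ (dr _).
have ds : dfun (fun z : 'rV[R]_(n + 1 + 1 + 1 + 1) => rsubmx z 0 0) := dr _.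
have dq : dfun (fun z : 'rV[R]_(n + 1 + 1 + 1 + 1) =>
    (f (rsubmx z 0 0 *: delta_mx 0 i + lsubmx (lsubmx (lsubmx (lsubmx z)))) -
     f (lsubmx (lsubmx (lsubmx (lsubmx z))))) * (rsubmx z 0 0)^-1).
  apply: definable_mul; last exact: definable_inv.
  apply: definable_sub => //; apply: definable_comp_row => // j.
  under eq_fun do rewrite mxE [X in X + _]mxE.
  apply: definable_add => //.
  by apply: definable_mul => //; exact: definable_cst.
apply: definable_imp; first by apply: definable_lt => //; exact: definable_mul.
apply: definable_imp.
  apply: definable_iff (definable_not (definable_eq ds (definable_cst _ 0))) => z /=.
  by split=> [/eqP|/eqP].
by apply: definable_and; apply: definable_lt => //; exact: definable_sub.
Unshelve. all: by end_near. Qed.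

End Definability.

(** * Calculus of C^k functions *)

Section CkCalculus.
Variables (R : realType) (n : nat).
Implicit Types (U V : set 'rV[R]_n) (f g : 'rV[R]_n -> R) (x : 'rV[R]_n).

Lemma Ck_continuous k U f : Ck k U f -> {in U, continuous f}.
Proof. by case: k => [|k] []. Qed.

Lemma Ck0 f : continuous f -> Ck 0 setT f.
Proof. by move=> cf; split=> // x _; exact: cf. Qed.

Lemma Ck_derivable k U f i x : Ck k.+1 U f -> U x ->
  derivable f x (delta_mx 0 i).
Proof. by move=> [_ /(_ i)[fi _]]; exact: fi. Qed.

Lemma Ck_partial k U f i : Ck k.+1 U f -> Ck k U (partial i f).
Proof. by move=> [_ /(_ i)[]]. Qed.

Lemma Ck_is_derive k U f i x : Ck k.+1 U f -> U x ->
  is_derive x (delta_mx 0 i) f (partial i f x).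
Proof. by move=> fU Ux; apply: derivableP; exact: Ck_derivable fU Ux. Qed.

Lemma CkW k U f : Ck k.+1 U f -> Ck k U f.
Proof.
elim: k f => [|k IH] f [cf df]; split=> // i.
by split=> [|]; [case: (df i)|apply: IH; case: (df i)].
Qed.

Lemma Ck_le j k U f : (j <= k)%N -> Ck k U f -> Ck j U f.
Proof.
by move=> /subnK <-; elim: (k - j)%N => [//|d IH] /CkW.
Qed.

Lemma Ck_subset k U V f : V `<=` U -> Ck k U f -> Ck k V f.
Proof.
move=> VU; elim: k f => [|k IH] f [cf df]; split.
- by move=> x /set_mem/VU/mem_set; exact: cf.
- by [].
- by move=> x /set_mem/VU/mem_set; exact: cf.
by move=> i; case: (df i) => dfi Cfi; split; [move=> x /VU; exact: dfi|exact: IH].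
Qed.

Lemma near_open U (P : 'rV[R]_n -> Prop) x :
  open U -> U x -> (forall y, U y -> P y) -> \forall y \near x, P y.
Proof. by move=> oU Ux UP; apply: filterS UP _; exact: open_nbhs_nbhs. Qed.

Lemma continuous_at_eq U f g x : open U -> U x -> (forall y, U y -> f y = g y) ->
  {for x, continuous f} -> {for x, continuous g}.
Proof.
move=> oU Ux fg; rewrite /prop_for /continuous_at -(fg x Ux) => cf.
have nfg : {near x, f =1 g} by exact: (near_open oU Ux).
exact: cvg_trans (near_eq_cvg nfg) cf.
Qed.

Lemma Ck_eq k U f g : open U -> (forall x, U x -> f x = g x) ->
  Ck k U f -> Ck k U g.
Proof.
move=> oU; elim: k f g => [|k IH] f g fg [cf df]; split=> //.
- move=> x xU; exact: continuous_at_eq oU (set_mem xU) fg (cf x xU).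
- move=> x xU; exact: continuous_at_eq oU (set_mem xU) fg (cf x xU).
have fgx x : U x -> \forall y \near x, f y = g y.
  by move=> Ux; exact: (near_open oU Ux).
move=> i; case: (df i) => dfi Cfi; split=> [x Ux|].
  by apply: near_eq_derivable (dfi x Ux); exact: fgx.
by apply: IH Cfi => x Ux; apply: near_eq_derive; exact: fgx.
Qed.

Lemma near_positive (I : finType) (w : I -> 'rV[R]_n -> R) x :
  (forall i, continuous (w i)) ->
  \forall y \near x, forall i, 0 < w i x -> 0 < w i y.
Proof.
move=> cw.
apply: (@filter_forall _ _ (fun i y => 0 < w i x -> 0 < w i y) _ (nbhs_filter x)) => i.
have [wi|wi] := ltP 0 (w i x); last exact: filterE.
by apply: filterS (cvgr_gt _ (cw i x) _ wi).
Qed.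

(** [partial] is defined as a limit; the inductions on k below go through this
    lemma, which lets explicit formulas for the partial derivatives stand for it. *)
Lemma CkS k U f (d : 'I_n -> 'rV[R]_n -> R) : open U ->
  {in U, continuous f} ->
  (forall i x, U x -> is_derive x (delta_mx 0 i) f (d i x)) ->
  (forall i, Ck k U (d i)) -> Ck k.+1 U f.
Proof.
move=> oU cf dfd Cd; split=> // i; split=> [x Ux|].
  by case: (dfd i x Ux).
by apply: Ck_eq (Cd i) => // x Ux; case: (dfd i x Ux).
Qed.

Lemma Ck_cst k U (c : R) : open U -> Ck k U (fun=> c).
Proof.
move=> oU; elim: k c => [|k IH] c.
  by split=> // x _; exact: cst_continuous.
apply: (CkS oU (d := fun _ _ => 0)) => // x _; exact: cst_continuous.
Qed.

Lemma is_derive_coord j x (v : 'rV[R]_n) :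
  is_derive x v (fun y : 'rV[R]_n => y 0 j) (v 0 j).
Proof.
apply: DeriveDef; first exact/diff_derivable/differentiable_coord.
apply/cvg_lim => //; apply: (@cvg_trans _ (cst (v 0 j) @ (0 : R)^')); last exact: cvg_cst.
apply: near_eq_cvg; near=> t; rewrite /= !mxE addrK scalerA mulVf ?scale1r//.
by near: t; exact: nbhs_dnbhs_neq.
Unshelve. all: by end_near. Qed.

Lemma Ck_coord k U j : open U -> Ck k U (fun x : 'rV[R]_n => x 0 j).
Proof.
move=> oU; case: k => [|k].
  by split=> // x _; exact: coord_continuous.
apply: (CkS oU (d := fun i _ => delta_mx (0 : 'I_1) i 0 j)) => [x _|i x _|i].
- exact: coord_continuous.
- exact: is_derive_coord.
- exact: Ck_cst.
Qed.

Lemma CkD k U f g : open U -> Ck k U f -> Ck k U g ->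
  Ck k U (fun x => f x + g x).
Proof.
move=> oU; elim: k f g => [|k IH] f g Cf Cg.
  split=> // x xU; apply: continuousD; first exact: (Ck_continuous Cf).
  exact: (Ck_continuous Cg).
apply: (CkS oU (d := fun i x => partial i f x + partial i g x)) => [x xU|i x Ux|i].
- apply: continuousD; first exact: (Ck_continuous Cf).
  exact: (Ck_continuous Cg).
- by apply: is_deriveD; apply: Ck_is_derive Ux; [exact: Cf|exact: Cg].
- by apply: IH; exact: Ck_partial.
Qed.

Lemma CkM k U f g : open U -> Ck k U f -> Ck k U g ->
  Ck k U (fun x => f x * g x).
Proof.
move=> oU; elim: k f g => [|k IH] f g Cf Cg.
  split=> // x xU; apply: continuousM; first exact: (Ck_continuous Cf).
  exact: (Ck_continuous Cg).
apply: (CkS oU (d := fun i x => f x * partial i g x + g x * partial i f x))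
  => [x xU|i x Ux|i].
- apply: continuousM; first exact: (Ck_continuous Cf).
  exact: (Ck_continuous Cg).
- have df := Ck_is_derive i Cf Ux; have dg := Ck_is_derive i Cg Ux.
  by apply: is_derive_eq (is_deriveM df dg) _.
- apply: CkD => //; apply: IH; [exact: CkW|exact: Ck_partial|exact: CkW|].
  exact: Ck_partial.
Qed.

Lemma CkN k U f : open U -> Ck k U f -> Ck k U (fun x => - f x).
Proof.
move=> oU Cf; apply: Ck_eq (CkM oU (Ck_cst k (-1) oU) Cf) => // x _.
by rewrite mulN1r.
Qed.

Lemma CkB k U f g : open U -> Ck k U f -> Ck k U g ->
  Ck k U (fun x => f x - g x).
Proof. by move=> oU Cf Cg; apply: CkD => //; exact: CkN. Qed.

Lemma Ck_sum k U (I : Type) (s : seq I) (P : pred I) (f : I -> 'rV[R]_n -> R) :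
  open U -> (forall i, P i -> Ck k U (f i)) ->
  Ck k U (fun x => \sum_(i <- s | P i) f i x).
Proof.
move=> oU Cf; elim: s => [|i s IH].
  by under eq_fun do rewrite big_nil; exact: Ck_cst.
under eq_fun do rewrite big_cons; have [/Cf Cfi|//] := boolP (P i).
exact: CkD.
Qed.

Lemma line_cvg x (v : 'rV[R]_n) : (fun s : R => s *: v + x) @ (0 : R) --> x.
Proof.
rewrite -[X in _ --> X]add0r -(scale0r v).
by apply: cvgD; [apply: cvgZr_tmp; exact: cvg_id|exact: cvg_cst].
Qed.

(** Directional derivatives are derivatives of one real variable, which gives
    access to the chain rule and to the mean value theorem. *)
Lemma is_derive_line f x (v : 'rV[R]_n) (s d : R) :
  is_derive (s *: v + x) v f d <-> is_derive s (1 : R) (fun t : R => f (t *: v + x)) d.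
Proof.
pose g1 h := h^-1 *: ((f \o shift (s *: v + x)) (h *: v) - f (s *: v + x)).
pose g2 h := h^-1 *: (((fun t : R => f (t *: v + x)) \o shift s) (h *: (1 : R)) -
  f (s *: v + x)).
have g12 : g1 = g2.
  by apply/funext => h; rewrite /g1 /g2 /= scalerDl addrA [h *: 1]mulr1.
split=> -[fxv fd]; apply: DeriveDef.
- by rewrite /derivable -/g2 -g12; exact: fxv.
- by rewrite -fd /derive -/g2 -g12.
- by rewrite /derivable -/g1 g12; exact: fxv.
- by rewrite -fd /derive -/g1 g12.
Qed.

Lemma is_derive_bigsum (I : Type) (s : seq I) (P : pred I)
    (F : I -> 'rV[R]_n -> R) (d : I -> R) x (v : 'rV[R]_n) :
  (forall i, is_derive x v (F i) (d i)) ->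
  is_derive x v (fun y => \sum_(i <- s | P i) F i y) (\sum_(i <- s | P i) d i).
Proof.
move=> dF; elim: s => [|i s IH].
  by under eq_fun do rewrite big_nil; rewrite big_nil; exact: is_derive_cst.
rewrite big_cons; under eq_fun do rewrite big_cons.
by case: (P i) => //; exact: is_deriveD.
Qed.

Lemma is_derive_comp1 (op : R -> R) f x (v : 'rV[R]_n) (a b : R) :
  is_derive (f x) 1 op a -> is_derive x v f b ->
  is_derive x v (fun y => op (f y)) (a * b).
Proof.
rewrite -{2 3}[x]add0r -(scale0r v) => dop /is_derive_line df; apply/is_derive_line.
apply: (@is_derive1_comp _ op (fun t => f (t *: v + x))) => //.
by rewrite scale0r add0r.
Qed.

Lemma Ck_inv k U f : open U -> (forall x, U x -> f x != 0) ->
  Ck k U f -> Ck k U (fun x => (f x)^-1).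
Proof.
move=> oU f0; elim: k f f0 => [|k IH] f f0 Cf.
  split=> // x xU; apply: continuousV; first exact/f0/set_mem.
  exact: (Ck_continuous Cf).
apply: (CkS oU (d := fun i x => - ((f x)^-1 * (f x)^-1) * partial i f x))
  => [x xU|i x Ux|i].
- apply: continuousV; first exact/f0/set_mem.
  exact: (Ck_continuous Cf).
- apply: (is_derive_comp1 (op := fun y => y^-1)); last exact: Ck_is_derive Cf Ux.
  have d1 := is_deriveV (f0 _ Ux) (is_derive_id (f x) (1 : R)).
  by apply: (is_derive_eq d1); rewrite [_ *: _]mulr1 -exprVn expr2.
- have Cinv := IH f f0 (CkW Cf).
  apply: CkM => //; last exact: Ck_partial.
  by apply: CkN => //; exact: CkM.
Qed.

Lemma Ck_sqrt k U f : open U -> (forall x, U x -> 0 < f x) ->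
  Ck k U f -> Ck k U (fun x => Num.sqrt (f x)).
Proof.
move=> oU f0; elim: k f f0 => [|k IH] f f0 Cf.
  split=> // x xU.
  apply: (@continuous_comp _ _ _ f Num.sqrt); first exact: (Ck_continuous Cf).
  exact: sqrt_continuous.
apply: (CkS oU (d := fun i x => (2 * Num.sqrt (f x))^-1 * partial i f x))
  => [x xU|i x Ux|i].
- apply: (@continuous_comp _ _ _ f Num.sqrt); first exact: (Ck_continuous Cf).
  exact: sqrt_continuous.
- apply: (is_derive_comp1 (op := Num.sqrt)); last exact: Ck_is_derive Cf Ux.
  by apply: is_derive1_sqrt; exact: f0.
- apply: CkM => //; last exact: Ck_partial.
  apply: Ck_inv => // [x Ux|].
    by rewrite mulf_neq0// gt_eqF// ?sqrtr_gt0// f0.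
  by apply: CkM => //; [exact: Ck_cst|apply: IH => //; exact: CkW].
Qed.

End CkCalculus.

(** * Averages over the unit interval *)

Lemma continuous_at_dist (R : realType) (V : normedModType R) (f : V -> R) (x : V) :
  (forall e, 0 < e -> \forall y \near x, `|f x - f y| <= e) ->
  {for x, continuous f}.
Proof. by move=> H; apply/cvgrPdist_le. Qed.

Section Averaging.
Variable R : realType.

Let mu : {measure set (measurableTypeR R) -> \bar R} := @lebesgue_measure R.

Definition mean01 (u : R -> R) : R := \int[mu]_(t in `[0, 1]%classic) u t.

Lemma continuous_integrable01 (u : R -> R) : continuous u ->
  mu.-integrable `[0, 1]%classic (EFin \o u).
Proof.
move=> cu; apply: continuous_compact_integrable; first exact: segment_compact.
exact: continuous_subspaceT.
Qed.

Lemma mean01B (u v : R -> R) : continuous u -> continuous v ->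
  mean01 (fun t => u t - v t) = mean01 u - mean01 v.
Proof.
by move=> cu cv; rewrite /mean01 RintegralB//; exact: continuous_integrable01.
Qed.

Lemma mean01Z (c : R) (u : R -> R) : continuous u ->
  mean01 (fun t => c * u t) = c * mean01 u.
Proof.
by move=> cu; rewrite /mean01 RintegralZl//; exact: continuous_integrable01.
Qed.

Lemma mean01_cst (c : R) : mean01 (fun=> c) = c.
Proof.
rewrite /mean01 Rintegral_cst//= lebesgue_measure_itv/= lte_fin ltr01.
by rewrite oppr0 adde0 mulr1.
Qed.

Lemma mean01_bound (u : R -> R) (M : R) : continuous u ->
  (forall t, 0 <= t <= 1 -> `|u t| <= M) -> `|mean01 u| <= M.
Proof.
move=> cu uM; rewrite -[leRHS]mean01_cst.
apply: le_trans (le_normr_Rintegral _ (continuous_integrable01 cu)) _ => //.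
apply: le_Rintegral => //.
- apply: (continuous_integrable01 (u := fun t => `|u t|)) => t.
  by apply: continuous_comp; [exact: cu|exact: norm_continuous].
- by apply: (continuous_integrable01 (u := fun=> M)) => t; exact: cst_continuous.
Qed.

Lemma mean01_ftc (u v : R -> R) : continuous v ->
  (forall t, is_derive t (1 : R) u (v t)) -> mean01 v = u 1 - u 0.
Proof.
move=> cv duv.
have cu : continuous u.
  by move=> t; apply/differentiable_continuous/derivable1_diffP; case: (duv t).
rewrite /mean01 /Rintegral (continuous_FTC2 (F := u))//.
- exact: continuous_subspaceT.
- split=> [t _||]; first by case: (duv t).
    by apply: cvg_at_right_filter; exact: cu.
  by apply: cvg_at_left_filter; exact: cu.
- by move=> t _; rewrite derive1E; case: (duv t).
Qed.

Lemma is_derive_line_mvt (phi dphi : R -> R) (h : R) :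
  (forall s, is_derive s (1 : R) phi (dphi s)) ->
  exists2 xi, `|xi| <= `|h| & phi h - phi 0 = dphi xi * h.
Proof.
move=> dp.
have cp : continuous phi.
  by move=> t; apply/differentiable_continuous/derivable1_diffP; case: (dp t).
have [h0|h0] := leP 0 h.
  have [xi] := MVT_segment h0 (fun s _ => dp s) (continuous_subspaceT cp).
  rewrite in_itv /= subr0 => /andP[xi0 xih] ->; exists xi => //.
  by rewrite !ger0_norm.
have [xi] := MVT_segment (ltW h0) (fun s _ => dp s) (continuous_subspaceT cp).
rewrite in_itv /= sub0r => /andP[xih xi0] e; exists xi.
  by rewrite !ler0_norm ?lerN2// ltW.
by rewrite -[LHS]opprB e mulrN opprK.
Qed.

Variable n : nat.
Implicit Types (Phi Psi : R -> 'rV[R]_n -> R) (x : 'rV[R]_n).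

Let jointly_continuous Phi := continuous (fun p : R * 'rV[R]_n => Phi p.1 p.2).

Lemma jointly_continuous1 Phi x : jointly_continuous Phi -> continuous (Phi ^~ x).
Proof.
move=> cP t; apply: (@continuous_comp _ _ _ (fun t => (t, x)) (fun p => Phi p.1 p.2)).
  exact: (@cvg_pair _ _ _ _ (nbhs t) (nbhs x) _ _ _ id (fun=> x) (@cvg_id _ _)
    (@cvg_cst _ _ _ _ _)).
exact: cP.
Qed.

(** Tube lemma: the modulus of continuity in y is uniform in t because the unit
    interval is compact. *)
Lemma jointly_continuous_unif Phi x e : jointly_continuous Phi -> 0 < e ->
  \forall y \near x, forall t, 0 <= t <= 1 -> `|Phi t y - Phi t x| <= e.
Proof.
move=> cP e0.
have /compact_near_coveringP near01 := @segment_compact R 0 1.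
have H := near01 _ (nbhs x) (fun y t => `|Phi t y - Phi t x| <= e) (nbhs_filter x).
apply: filterS (H _) => [y Hy t t01|t _]; first by apply: Hy; rewrite /= in_itv.
have e2 : 0 < e / 2 by rewrite divr_gt0.
have /cvgrPdist_lt/(_ _ e2) H1 := cP (t, x).
have /cvgrPdist_lt/(_ _ e2) H2 := @jointly_continuous1 _ x cP t.
have {}H2 : \forall t' \near t & y \near x, `|Phi t x - Phi t' x| < e / 2.
  exists ([set t' | `|Phi t x - Phi t' x| < e / 2], setT) => /=.
    by split => //; exact: filterT.
  by move=> [a b] [].
apply: filterS2 H1 H2 => -[t' y] /=; set a := Phi t x => h1 h2.
rewrite (_ : _ - _ = (a - Phi t' x) - (a - Phi t' y)); last by ring.
by rewrite (le_trans (ler_normB _ _))// [e]splitr ltW// ltrD.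
Qed.

Lemma mean01_continuous Phi : jointly_continuous Phi ->
  continuous (fun x => mean01 (Phi ^~ x)).
Proof.
move=> cP x; apply: continuous_at_dist => e e0.
apply: filterS (jointly_continuous_unif x cP e0) => y Hy.
have c1 z : continuous (Phi ^~ z) by exact: jointly_continuous1.
rewrite -mean01B//; apply: mean01_bound => [t|t t01].
  by apply: continuousB; exact: c1.
by rewrite distrC Hy.
Qed.

(** By the mean value theorem the difference quotients of Phi t are values of
    Psi t near x, and these are close to Psi t x uniformly in t. *)
Lemma mean01_is_derive Phi Psi (v : 'rV[R]_n) : jointly_continuous Phi ->
  jointly_continuous Psi ->
  (forall t x, is_derive x v (Phi t) (Psi t x)) ->
  forall x, is_derive x v (fun x => mean01 (Phi ^~ x)) (mean01 (Psi ^~ x)).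
Proof.
move=> cP cQ dP x.
have c1 z : continuous (Phi ^~ z) by exact: jointly_continuous1.
have c2 z : continuous (Psi ^~ z) by exact: jointly_continuous1.
suff lim : (fun h => h^-1 *: (((fun x => mean01 (Phi ^~ x)) \o shift x) (h *: v) -
    mean01 (Phi ^~ x))) @ (0 : R)^' --> mean01 (Psi ^~ x).
  by apply: DeriveDef; [apply/cvg_ex; eexists; exact: lim|exact/cvg_lim].
apply/cvgrPdist_le => e e0.
have Q := jointly_continuous_unif x cQ e0.
have {}Q : \forall s \near (0 : R), forall t, 0 <= t <= 1 ->
    `|Psi t (s *: v + x) - Psi t x| <= e.
  exact: (@line_cvg _ _ x v _ Q).
have /nbhs_ballP[d /= d0 Hd] := Q.
near=> h.
have h0 : h != 0 by near: h; exact: nbhs_dnbhs_neq.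
have hd : `|h| < d by near: h; exact: dnbhs0_lt.
rewrite /= [_ *: _]mulrC -[_ * h^-1]mulrC.
have cB : continuous (fun t => Phi t (h *: v + x) - Phi t x).
  by move=> t; apply: continuousB; exact: c1.
rewrite -mean01B// -mean01Z// -mean01B//; last first.
  by move=> t; apply: cvgMl_tmp; exact: cB.
apply: mean01_bound => [t|t t01].
  by apply: cvgB; [exact: c2|apply: cvgMl_tmp; exact: cB].
have [|xi xih] := @is_derive_line_mvt (fun s => Phi t (s *: v + x))
  (fun s => Psi t (s *: v + x)) h.
  by move=> s; apply/is_derive_line; exact: dP.
rewrite scale0r add0r => ->; rewrite mulrC mulfK// distrC.
by apply: Hd => //; rewrite /ball /= sub0r normrN (le_lt_trans xih).
Unshelve. all: by end_near. Qed.

End Averaging.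

(** * Hadamard's lemma *)

Lemma continuous_rV (R : realType) (T : topologicalType) m (f : T -> 'rV[R]_m) :
  (forall j, continuous (fun p => f p 0 j)) -> continuous f.
Proof.
move=> cf p; apply/cvg_ballP => e e0.
have H : \forall q \near p, forall j, ball (f p 0 j) e (f q 0 j).
  by apply: filter_forall => j; exact: (cvg_ballP _ _).1 (cf j p) _ e0.
by apply: filterS H => q H; split=> // i j; rewrite (ord1 i).
Qed.

Section Hadamard.
Variables (R : realType) (n : nat).
Implicit Types (F : 'rV[R]_n -> R) (c x : 'rV[R]_n).

Lemma Ck_continuousT k F : Ck k setT F -> continuous F.
Proof. by move=> /Ck_continuous CF x; apply: CF; rewrite in_setT. Qed.

Definition rescale c (s : 'I_n -> R) x : 'rV[R]_n :=
  \row_b (c 0 b + s b * (x 0 b - c 0 b)).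

Lemma rescale_continuous (s : 'I_n -> R -> R) c : (forall b, continuous (s b)) ->
  continuous (fun p : R * 'rV[R]_n => rescale c (s ^~ p.1) p.2).
Proof.
move=> cs; apply: continuous_rV => j.
under eq_fun do rewrite mxE.
move=> p; apply: cvgD; first exact: cvg_cst.
apply: cvgM.
  by apply: (@continuous_comp _ _ _ fst (s j)); [exact: cvg_fst|exact: cs].
apply: cvgB; last exact: cvg_cst.
apply: (@continuous_comp _ _ _ snd (fun x : 'rV[R]_n => x 0 j)); first exact: cvg_snd.
exact: coord_continuous.
Qed.

Lemma rescale_shift (s : 'I_n -> R) c x b (h : R) :
  rescale c s (h *: delta_mx 0 b + x) = (s b * h) *: delta_mx 0 b + rescale c s x.
Proof.
apply/rowP => j; rewrite !mxE eqxx /=; case: (eqVneq j b) => [->|_]; last first.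
  by rewrite !mulr0 !add0r.
by rewrite !mulr1; ring.
Qed.

Lemma is_derive_rescale F (s : 'I_n -> R) c x b d :
  is_derive (rescale c s x) (delta_mx 0 b) F d ->
  is_derive x (delta_mx 0 b) (fun x => F (rescale c s x)) (d * s b).
Proof.
move=> dF; rewrite -[x]add0r -(scale0r (delta_mx 0 b)); apply/is_derive_line.
under eq_fun do rewrite rescale_shift.
apply: (@is_derive1_comp _ (fun r => F (r *: delta_mx 0 b + rescale c s x))
  (fun h => s b * h)).
  by apply/is_derive_line; rewrite mulr0 scale0r add0r.
have dZ := is_deriveZ (s b) (is_derive_id (0 : R) (1 : R)).
by apply: (is_derive_eq dZ); rewrite [_ *: _]mulr1.
Qed.

(** Differentiation under the integral sign only changes the weight w, so the
    class of these means is stable under it; this is why the weight is there. *)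
Lemma Ck_mean01_rescale k (w : R -> R) (s : 'I_n -> R -> R) c F :
  continuous w -> (forall b, continuous (s b)) -> Ck k setT F ->
  Ck k setT (fun x => mean01 (fun t => w t * F (rescale c (s ^~ t) x))).
Proof.
move=> + cs; have jc (v : R -> R) (G : 'rV[R]_n -> R) : continuous v ->
    continuous G ->
    continuous (fun p : R * 'rV[R]_n => v p.1 * G (rescale c (s ^~ p.1) p.2)).
  move=> cv cG p; apply: cvgM.
    by apply: (@continuous_comp _ _ _ fst v); [exact: cvg_fst|exact: cv].
  by apply: (@continuous_comp _ _ _ (fun p : R * 'rV[R]_n =>
    rescale c (s ^~ p.1) p.2) G); [exact: rescale_continuous|exact: cG].
elim: k w F => [|k IH] w F cw CF.
- apply: Ck0.
  apply: (@mean01_continuous _ _ (fun t x => w t * F (rescale c (s ^~ t) x))).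
  by apply: jc => //; exact: Ck_continuousT CF.
apply: (CkS (@openT _) (d := fun b x =>
  mean01 (fun t => (w t * s b t) * partial b F (rescale c (s ^~ t) x)))).
- move=> x _.
  apply: (@mean01_continuous _ _ (fun t x => w t * F (rescale c (s ^~ t) x))).
  by apply: jc => //; exact: Ck_continuousT CF.
- move=> b x _.
  apply: (@mean01_is_derive _ _ (fun t x => w t * F (rescale c (s ^~ t) x))
    (fun t x => (w t * s b t) * partial b F (rescale c (s ^~ t) x))).
  + by apply: jc => //; exact: Ck_continuousT CF.
  + apply: (jc (fun t => w t * s b t)); last exact: Ck_continuousT (Ck_partial b CF).
    by move=> t; apply: cvgM; [exact: cw|exact: cs].
  + move=> t y; have dF := is_derive_rescale (Ck_is_derive b CF (I : setT (rescale c (s ^~ t) y))).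
    have dZ := is_deriveZ (w t) dF.
    by apply: (is_derive_eq dZ); rewrite [_ *: _]mulrA mulrAC.
- move=> b; apply: IH; last exact: Ck_partial CF.
  by move=> t; apply: cvgM; [exact: cw|exact: cs].
Qed.

(** Scaling factors of step a of the staircase from c to x: the coordinates
    before a have arrived at x, coordinate a moves with t, and the later ones
    are still at c. *)
Let stair (a b : 'I_n) (t : R) : R :=
  if (b < a)%N then 1 else if b == a then t else 0.

Let stair_continuous a b : continuous (stair a b).
Proof.
rewrite /stair; case: (b < a)%N => [t|]; first exact: cvg_cst.
by case: (b == a) => t; [exact: cvg_id|exact: cvg_cst].
Qed.

Let prefix c j x : 'rV[R]_n := \row_b (if (b < j)%N then x 0 b else c 0 b).

Let rescale_stair c a x t : rescale c (stair a ^~ t) x =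
  (t * (x 0 a - c 0 a)) *: delta_mx 0 a + prefix c a x.
Proof.
apply/rowP => b; rewrite !mxE eqxx /stair /=.
case: (eqVneq b a) => [->|ba] /=; first by rewrite ltnn; ring.
by case: ifP => _ /=; ring.
Qed.

Let prefixS c (a : 'I_n) x : prefix c a.+1 x = (x 0 a - c 0 a) *: delta_mx 0 a + prefix c a x.
Proof.
apply/rowP => b; rewrite !mxE eqxx /= ltnS leq_eqVlt (val_eqE b a).
by case: (eqVneq b a) => [->|ba] /=; [rewrite ltnn; ring|case: ifP => _; ring].
Qed.

(** F x - F c is the telescoping sum of the increments of F along the staircase
    from c to x that changes one coordinate at a time.  The increment of step a is
    (x_a - c_a) q_a(x), where q_a(x) is the mean of the a-th partial derivative
    over that step. *)
Lemma definable_hadamard (D : forall n, set (set 'rV[R]_n)) k F c :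
  ominimal_structure D -> definable_Ck D k.+1 setT F ->
  exists q : 'I_n -> 'rV[R]_n -> R, (forall a, definable_Ck D k setT (q a)) /\
    forall x, F x = F c + \sum_a (x 0 a - c 0 a) * q a x.
Proof.
move=> hD [dF CF].
pose q a x := mean01 (fun t => partial a F (rescale c (stair a ^~ t) x)).
have qC a : Ck k setT (q a).
  have := Ck_mean01_rescale c (@cst_continuous _ _ (1 : R)) (@stair_continuous a)
    (Ck_partial a CF).
  rewrite (_ : (fun x => _) = q a)//; apply/funext => x.
  by rewrite /q; congr mean01; apply/funext => t; rewrite mul1r.
have qE a x : (x 0 a - c 0 a) * q a x = F (prefix c a.+1 x) - F (prefix c a x).
  set y := x 0 a - c 0 a.
  have cp : continuous (fun t => partial a F (rescale c (stair a ^~ t) x)).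
    apply: (@jointly_continuous1 _ _ (fun t x => partial a F (rescale c (stair a ^~ t) x))).
    move=> p; apply: (@continuous_comp _ _ _ (fun p : R * 'rV[R]_n =>
      rescale c (stair a ^~ p.1) p.2) (partial a F)).
      exact: rescale_continuous (@stair_continuous a) p.
    exact: Ck_continuousT (Ck_partial a CF) _.
  rewrite /q -mean01Z//.
  have dy t : is_derive t (1 : R) (fun t => F (rescale c (stair a ^~ t) x))
      (y * partial a F (rescale c (stair a ^~ t) x)).
    under eq_fun do rewrite rescale_stair.
    have d1 : is_derive t (1 : R) (fun t : R => t * y) y.
      have := is_deriveZ y (is_derive_id t (1 : R)).
      rewrite [_ *: 1]mulr1 (_ : y \*: id = fun t => t * y)//.
      by apply/funext => r; rewrite /= [_ *: _]mulrC.
    rewrite mulrC.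
    apply: (@is_derive1_comp _ (fun r => F (r *: delta_mx 0 a + prefix c a x))
      (fun t => t * y)) => //.
    by apply/is_derive_line; rewrite -rescale_stair; exact: Ck_is_derive CF I.
  rewrite (mean01_ftc _ dy) => [|t]; last by apply: cvgMl_tmp; exact: cp.
  by rewrite !rescale_stair mul1r mul0r scale0r add0r -prefixS.
exists q; split=> [a|x].
  split=> //.
  have -> : q a = fun x => if x 0 a == c 0 a then partial a F (prefix c a x)
      else (F (prefix c a.+1 x) - F (prefix c a x)) * (x 0 a - c 0 a)^-1.
    apply/funext => x; case: eqVneq => [xa|xa].
      rewrite /q -[RHS]mean01_cst; congr mean01; apply/funext => t.
      by rewrite rescale_stair xa subrr mulr0 scale0r add0r.
    by rewrite -qE mulrAC divff ?mul1r// subr_eq0.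
  have dpre j G : definable_fun D setT G ->
      definable_fun D setT (fun x => G (prefix c j x)).
    move=> dG; apply: definable_comp_row => // b.
    under eq_fun do rewrite mxE; case: (b < j)%N; first exact: definable_coord.
    exact: definable_cst.
  have dxa := definable_coord hD a.
  have dca := definable_cst hD n (c 0 a).
  apply: definable_if => //.
  - by apply: definable_iff (definable_eq hD dxa dca) => x /=; split=> [->|/eqP].
  - apply: dpre; apply: definable_partial => // x.
    exact: Ck_derivable CF I.
  - apply: definable_mul => //; first by apply: definable_sub => //; exact: dpre.
    by apply: definable_inv => //; exact: definable_sub.
under eq_bigr do rewrite qE.
rewrite -(big_mkord xpredT (fun a => F (prefix c a.+1 x) - F (prefix c a x))).
rewrite telescope_sumr// addrC.
have -> : prefix c 0 x = c by apply/rowP => b; rewrite mxE ltn0.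
have -> : prefix c n x = x by apply/rowP => b; rewrite mxE ltn_ord.
by rewrite subrK.
Qed.

End Hadamard.

(** * Quadratic forms and compactness *)

Section CompactPenalty.
Variable R : realType.

(** Where b is positive a large N makes the sum positive, and where b vanishes a
    is positive already; compactness makes the choice of N uniform. *)
Lemma compact_penalty (T : topologicalType) (K : set T) (a b : T -> R) :
  compact K -> continuous a -> continuous b -> (forall x, 0 <= b x) ->
  (forall x, K x -> b x = 0 -> 0 < a x) ->
  exists N : nat, forall x, K x -> 0 < a x + N%:R * b x.
Proof.
move=> /compact_near_coveringP cK ca cb b0 ab.
have H := cK _ \oo (fun N x => 0 < a x + N%:R * b x) _.
have /H[N _ HN] : forall x, K x ->
    \forall x' \near x & N \near \oo, 0 < a x' + N%:R * b x'.
  move=> x Kx; have [bx0|bx0] := eqVneq (b x) 0.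
    exists ([set y | 0 < a y], setT) => [|[y N] [/= ay _]].
      by split=> /=; [exact: (cvgr_gt _ (ca x) _ (ab x Kx bx0))|exact: filterT].
    by rewrite (lt_le_trans ay)// lerDl mulr_ge0.
  have bx : 0 < b x by rewrite lt_neqAle eq_sym bx0 b0.
  have bx2 : b x / 2 < b x by rewrite gtr_pMr// invf_lt1// ltr1n.
  have ax1 : a x - 1 < a x by rewrite ltrBlDr ltrDl.
  pose N0 := Num.bound `|(1 - a x) / (b x / 2)|.
  exists ([set y | a x - 1 < a y /\ b x / 2 < b y], [set N | (N0 <= N)%N]) => /=.
    split=> /=; last by exists N0.
    by apply: filterI; [exact: (cvgr_gt _ (ca x))|exact: (cvgr_gt _ (cb x))].
  move=> [y N] [/= [ay bY] N0N].
  have b20 : 0 < b x / 2 by rewrite divr_gt0.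
  have h1 : 1 - a x <= N%:R * (b x / 2).
    rewrite -ler_pdivrMr//; apply: le_trans (ler_norm _) _.
    apply: le_trans (ltW (archi_boundP (normr_ge0 _))) _.
    by rewrite ler_nat.
  have h2 : N%:R * (b x / 2) <= N%:R * b y by rewrite ler_wpM2l// ltW.
  by lra.
by exists N => x; apply: (HN N) => /=.
Qed.

End CompactPenalty.
Section QuadraticForms.
Variable R : realType.

Definition qform n (A : 'I_n -> 'I_n -> R) (v : 'I_n -> R) : R :=
  \sum_a \sum_b v a * v b * A a b.

Lemma qformZ n (A : 'I_n -> 'I_n -> R) (s : R) v :
  qform A (fun a => s * v a) = s ^+ 2 * qform A v.
Proof.
rewrite /qform mulr_sumr; apply: eq_bigr => a _.
by rewrite mulr_sumr; apply: eq_bigr => b _; ring.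
Qed.

Lemma compact_box n (c : 'rV[R]_n) (r : R) :
  compact [set v : 'rV[R]_n | forall i, v 0 i \in `[c 0 i - r, c 0 i + r]].
Proof.
apply: (rV_compact (A := fun i => `[c 0 i - r, c 0 i + r]%classic)) => i.
exact: segment_compact.
Qed.

Lemma closed_level n (f : 'rV[R]_n -> R) (c : R) :
  continuous f -> closed [set v | f v = c].
Proof.
move=> cf; apply: (@closed_comp _ _ f [set c]) => [x _|]; first exact: cf.
exact: closed_eq.
Qed.

Lemma compact_unit_sphere n : compact [set v : 'rV[R]_n | \sum_a v 0 a ^+ 2 = 1].
Proof.
have oT := @openT 'rV[R]_n.
have clS : closed [set v : 'rV[R]_n | \sum_a v 0 a ^+ 2 = 1].
  apply: closed_level; exact: Ck_continuousT (Ck_sum _ oT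
    (fun a _ => CkM oT (Ck_coord 0 a oT) (Ck_coord 0 a oT))).
apply: (subclosed_compact clS (@compact_box _ 0 1)) => v /= v1 i.
rewrite mxE sub0r add0r in_itv /= -ler_norml.
rewrite -(@expr_le1 _ 2)// real_normK ?num_real// -v1 (bigD1 i)//= lerDl.
by apply: sumr_ge0 => j _; rewrite sqr_ge0.
Qed.

(** The form is positive on the common kernel of the linear forms G_j, so
    [compact_penalty] on the unit sphere provides N.  A second use of the same
    lemma, with a = -1, bounds the resulting positive function away from 0. *)
Lemma finsler n (J : finType) (A : 'I_n -> 'I_n -> R) (G : J -> 'I_n -> R) :
  (forall v : 'I_n -> R, (exists a, v a != 0) ->
     (forall j, \sum_a v a * G j a = 0) -> 0 < qform A v) ->
  exists N : nat, exists2 e : R, 0 < e & forall v : 'I_n -> R,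
    e * \sum_a v a ^+ 2 <= qform A v + N%:R * \sum_j (\sum_a v a * G j a) ^+ 2.
Proof.
move=> Apos.
pose sq (v : 'rV[R]_n) := \sum_a v 0 a ^+ 2.
pose qA (v : 'rV[R]_n) := qform A (fun a => v 0 a).
pose pG (v : 'rV[R]_n) := \sum_j (\sum_a v 0 a * G j a) ^+ 2.
have Cx k i : Ck k setT (fun v : 'rV[R]_n => v 0 i) by apply: Ck_coord; exact: openT.
have Cc k (r : R) : Ck k setT (fun v : 'rV[R]_n => r) by apply: Ck_cst; exact: openT.
have CqA : Ck 0 setT qA.
  apply: Ck_sum => [|a _]; first exact: openT.
  apply: Ck_sum => [|b _]; first exact: openT.
  by do 2 (apply: CkM => //; first exact: openT).
have CpG : Ck 0 setT pG.
  apply: Ck_sum => [|j _]; first exact: openT.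
  apply: CkM; first exact: openT.
    by apply: Ck_sum => [|a _]; [exact: openT|apply: CkM => //; exact: openT].
  by apply: Ck_sum => [|a _]; [exact: openT|apply: CkM => //; exact: openT].
have cqA := Ck_continuousT CqA; have cpG := Ck_continuousT CpG.
have pG0 v : 0 <= pG v by apply: sumr_ge0 => j _; rewrite sqr_ge0.
pose K := [set v : 'rV[R]_n | sq v = 1].
have cK : compact K by exact: compact_unit_sphere.
have [|N HN] := compact_penalty cK cqA cpG pG0.
  move=> v Kv pGv; apply: Apos => [|j].
    apply: contrapT => /forallNP v0; move: Kv; rewrite /K /= /sq big1 => [/esym/eqP|a _].
      by rewrite oner_eq0.
    by have /negP := v0 a; rewrite negbK => /eqP ->; rewrite expr0n.
  apply/eqP; rewrite -sqrf_eq0; apply/eqP.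
  exact: (psumr_eq0P (fun j _ => sqr_ge0 (\sum_a v 0 a * G j a)) pGv).
pose b v := `|qA v + N%:R * pG v|.
have cb : continuous b.
  move=> v; apply: (@continuous_comp _ _ _ (fun v => qA v + N%:R * pG v) Num.norm).
    apply: (Ck_continuousT (k := 0)); apply: CkD => //; first exact: openT.
    by apply: CkM => //; exact: openT.
  exact: norm_continuous.
have [|M HM] := compact_penalty cK (@cst_continuous _ _ (-1 : R)) cb
    (fun v => normr_ge0 _).
  by move=> v Kv /eqP; rewrite normr_eq0 gt_eqF// HN.
have {}HM v : K v -> 1 < M%:R * (qA v + N%:R * pG v).
  move=> Kv; have := HM v Kv; rewrite /b ger0_norm; last exact/ltW/HN.
  by rewrite addrC subr_gt0.
exists N, (M.+1%:R)^-1 => [|v]; first by rewrite invr_gt0.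
have [s0|s0] := eqVneq (\sum_a v a ^+ 2) 0.
  have v0 a : v a = 0.
    apply/eqP; rewrite -sqrf_eq0; apply/eqP.
    exact: (psumr_eq0P (fun a _ => sqr_ge0 (v a)) s0).
  rewrite s0 mulr0 addr_ge0//.
    by rewrite /qform big1// => a _; rewrite big1// => c _; rewrite v0 !mul0r.
  by rewrite mulr_ge0// sumr_ge0// => j _; rewrite sqr_ge0.
set S := \sum_a v a ^+ 2 in s0 *.
have S0 : 0 < S by rewrite lt_neqAle eq_sym s0 sumr_ge0// => a _; rewrite sqr_ge0.
pose s := Num.sqrt S; have s2 : s ^+ 2 = S by rewrite sqr_sqrtr// ltW.
have sn0 : s != 0 by rewrite gt_eqF// sqrtr_gt0.
pose w : 'rV[R]_n := \row_a (s^-1 * v a).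
have vw : v = (fun a => s * w 0 a).
  by apply/funext => a; rewrite mxE mulrA divff// mul1r.
have Kw : K w.
  rewrite /K /= /sq; under eq_bigr do rewrite mxE exprMn.
  by rewrite -mulr_sumr -/S -s2 exprVn mulVf// expf_neq0.
have -> : qform A v = S * qA w by rewrite -s2 {1}vw qformZ.
have -> : \sum_j (\sum_a v a * G j a) ^+ 2 = S * pG w.
  rewrite -s2 /pG mulr_sumr; apply: eq_bigr => j _.
  rewrite -exprMn mulr_sumr; congr (_ ^+ 2).
  by apply: eq_bigr => a _; rewrite {1}vw mulrA.
rewrite [X in _ <= _ + X]mulrCA -mulrDr [leLHS]mulrC ler_pM2l// -[leLHS]mulr1 ler_pdivrMl//.
apply: (ltW (lt_le_trans (HM w Kw) _)).
by rewrite ler_wpM2r// ?ler_nat// ltW// HN.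
Qed.

(** Cholesky decomposition: completing the square in the first variable leaves a
    positive definite form in the others; 2 d_b is the coefficient of the product
    of the first variable with variable b. *)
Lemma qform_sum_squares n (A : 'I_n -> 'I_n -> R) :
  (forall v : 'I_n -> R, (exists a, v a != 0) -> 0 < qform A v) ->
  exists L : 'I_n -> 'I_n -> R,
    forall v, qform A v = \sum_r (\sum_a L r a * v a) ^+ 2.
Proof.
elim: n A => [|n IH] A Apos; first by exists A => v; rewrite /qform !big_ord0.
pose al := A ord0 ord0.
pose d b := (A ord0 (lift ord0 b) + A (lift ord0 b) ord0) / 2.
pose B b c := A (lift ord0 b) (lift ord0 c).
have AE v : qform A v = al * v ord0 ^+ 2 +
    2 * v ord0 * (\sum_b d b * v (lift ord0 b)) + qform B (fun b => v (lift ord0 b)).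
  rewrite /qform big_ord_recl big_ord_recl.
  under [X in _ + X = _]eq_bigr do rewrite big_ord_recl.
  rewrite big_split /= addrA; congr (_ + _); rewrite -addrA; congr (_ + _).
    by rewrite /al; ring.
  rewrite -big_split mulr_sumr /=; apply: eq_bigr => b _.
  by rewrite /d; field.
have al0 : 0 < al.
  pose v (a : 'I_n.+1) : R := if unlift ord0 a is Some _ then 0 else 1.
  have v0 : v ord0 = 1 by rewrite /v unlift_none.
  have vS b : v (lift ord0 b) = 0 by rewrite /v liftK.
  have := Apos v; rewrite AE v0.
  rewrite big1 => [|b _]; last by rewrite vS mulr0.
  rewrite /qform big1 => [|b _]; last by rewrite big1// => c _; rewrite vS !mul0r.
  rewrite expr1n !mulr1 mulr0 !addr0; apply; exists ord0.
  by rewrite v0 oner_eq0.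
pose C b c := B b c - d b * d c / al.
have CE w : qform C w = qform B w - (\sum_b d b * w b) ^+ 2 / al.
  rewrite /qform expr2 mulr_suml mulr_suml -sumrB; apply: eq_bigr => b _.
  rewrite mulr_sumr mulr_suml -sumrB; apply: eq_bigr => c _.
  by rewrite /C; field; rewrite gt_eqF.
have [|L HL] := IH C.
  move=> w [a wa].
  pose v (b : 'I_n.+1) := if unlift ord0 b is Some b' then w b'
    else - (\sum_b d b * w b) / al.
  have v0 : v ord0 = - (\sum_b d b * w b) / al by rewrite /v unlift_none.
  have vS b : v (lift ord0 b) = w b by rewrite /v liftK.
  have := Apos v; rewrite AE v0; under [X in 2 * _ * X]eq_bigr do rewrite vS.
  rewrite (_ : (fun b => v (lift ord0 b)) = w); last exact/funext.
  rewrite CE; set z := \sum_b _ => H.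
  suff -> : qform B w - z ^+ 2 / al =
      al * (- z / al) ^+ 2 + 2 * (- z / al) * z + qform B w.
    by apply: H; exists (lift ord0 a); rewrite vS.
  by field; rewrite gt_eqF.
pose sal := Num.sqrt al.
have sal0 : sal != 0 by rewrite gt_eqF// sqrtr_gt0.
have sal2 : al = sal ^+ 2 by rewrite sqr_sqrtr// ltW.
exists (fun r a => match unlift ord0 r, unlift ord0 a with
  | None, None => sal
  | None, Some b => d b / sal
  | Some _, None => 0
  | Some r, Some b => L r b
  end) => v.
rewrite big_ord_recl AE.
under [X in _ = _ + X]eq_bigr => r _.
  rewrite big_ord_recl liftK unlift_none mul0r add0r.
  under eq_bigr do rewrite liftK.
  over.
rewrite -HL CE big_ord_recl unlift_none.
under [X in _ = (_ + X) ^+ 2 + _]eq_bigr do rewrite liftK mulrAC.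
rewrite -mulr_suml; set z := \sum_b _; set q := qform B _.
by rewrite sal2; field.
Qed.

End QuadraticForms.

(** * Local sums of squares *)

Section DefinableCk.
Variables (R : realType) (D : forall n : nat, set (set 'rV[R]_n)).
Hypothesis hD : ominimal_structure D.
Variables (n k : nat).
Implicit Types (f g : 'rV[R]_n -> R) (U : set 'rV[R]_n).

Lemma definable_Ck_cst c : definable_Ck D k setT (fun _ : 'rV[R]_n => c).
Proof. by split; [exact: definable_cst|apply: Ck_cst; exact: openT]. Qed.

Lemma definable_Ck_coord i : definable_Ck D k setT (fun x : 'rV[R]_n => x 0 i).
Proof. by split; [exact: definable_coord|apply: Ck_coord; exact: openT]. Qed.

Lemma definable_CkD f g : definable_Ck D k setT f -> definable_Ck D k setT g ->
  definable_Ck D k setT (fun x => f x + g x).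
Proof.
by move=> [df Cf] [dg Cg]; split; [exact: definable_add|apply: CkD => //; exact: openT].
Qed.

Lemma definable_CkB f g : definable_Ck D k setT f -> definable_Ck D k setT g ->
  definable_Ck D k setT (fun x => f x - g x).
Proof.
by move=> [df Cf] [dg Cg]; split; [exact: definable_sub|apply: CkB => //; exact: openT].
Qed.

Lemma definable_CkM f g : definable_Ck D k setT f -> definable_Ck D k setT g ->
  definable_Ck D k setT (fun x => f x * g x).
Proof.
by move=> [df Cf] [dg Cg]; split; [exact: definable_mul|apply: CkM => //; exact: openT].
Qed.

Lemma definable_Ck_sum (I : Type) (s : seq I) (P : pred I) (f : I -> 'rV[R]_n -> R) :
  (forall i, P i -> definable_Ck D k setT (f i)) ->
  definable_Ck D k setT (fun x => \sum_(i <- s | P i) f i x).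
Proof.
move=> H; split; first by apply: definable_sum => // i /H[].
by apply: Ck_sum => [|i /H[]//]; exact: openT.
Qed.

Lemma definable_Ck_le j f : (j <= k)%N -> definable_Ck D k setT f ->
  definable_Ck D j setT f.
Proof. by move=> jk [df Cf]; split => //; exact: Ck_le jk Cf. Qed.

Lemma definable_CkT U f : D U -> definable_Ck D k setT f -> definable_Ck D k U f.
Proof.
by move=> DU [df Cf]; split; [exact: definable_funW|exact: Ck_subset Cf].
Qed.

Lemma definable_Ck_sqrt U f : open U -> D U -> (forall x, U x -> 0 < f x) ->
  definable_Ck D k setT f -> definable_Ck D k U (fun x => Num.sqrt (f x)).
Proof.
move=> oU DU f0 [df Cf]; split; last by apply: Ck_sqrt => //; exact: Ck_subset Cf.
by apply: definable_funW => //; exact: definable_sqrt.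
Qed.

Lemma sum_of_squares0 U : sum_of_squares_Ck D k U (fun=> 0).
Proof.
by exists 0%N, (fun _ _ => 0); split=> [[]|x _] //; rewrite big_ord0.
Qed.

Lemma sum_of_squares_sqr U (q : 'rV[R]_n -> R) : definable_Ck D k U q ->
  sum_of_squares_Ck D k U (fun x => q x ^+ 2).
Proof. by move=> dq; exists 1%N, (fun=> q); split=> // x _; rewrite big_ord1. Qed.

Lemma sum_of_squaresD U f g : sum_of_squares_Ck D k U f ->
  sum_of_squares_Ck D k U g -> sum_of_squares_Ck D k U (fun x => f x + g x).
Proof.
move=> [N [q [dq fE]]] [M [r [dr gE]]].
exists (N + M)%N, (fun i => match fintype.split i with inl j => q j | inr j => r j end).
split=> [i|x Ux]; first by case: (fintype.split i).
rewrite fE// gE// big_split_ord /=; congr (_ + _); apply: eq_bigr => i _.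
  by rewrite (unsplitK (inl i)).
by rewrite (unsplitK (inr i)).
Qed.

Lemma sum_of_squares_sum U (I : Type) (s : seq I) (f : I -> 'rV[R]_n -> R) :
  (forall i, sum_of_squares_Ck D k U (f i)) ->
  sum_of_squares_Ck D k U (fun x => \sum_(i <- s) f i x).
Proof.
move=> H; elim: s => [|i s IH].
  by under eq_fun do rewrite big_nil; exact: sum_of_squares0.
by under eq_fun do rewrite big_cons; exact: sum_of_squaresD.
Qed.

Lemma sum_of_squares_pos U f : open U -> D U -> (forall x, U x -> 0 < f x) ->
  definable_Ck D k setT f -> sum_of_squares_Ck D k U f.
Proof.
move=> oU DU f0 df; exists 1%N, (fun _ x => Num.sqrt (f x)).
split=> [_|x Ux]; first exact: definable_Ck_sqrt.
by rewrite big_ord1 sqr_sqrtr// ltW// f0.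
Qed.

Lemma definable_open_pos (I : finType) (w : I -> 'rV[R]_n -> R) :
  (forall i, definable_Ck D k setT (w i)) ->
  open [set x | forall i, 0 < w i x] /\ D [set x | forall i, 0 < w i x].
Proof.
move=> dw; split.
  rewrite openE => x wx; rewrite /interior /=.
  have : \forall y \near x, forall i, 0 < w i y.
    have cw i : continuous (w i) by case: (dw i) => _ /Ck_continuousT.
    by apply: filterS (near_positive x cw) => y wy i; exact: wy.
  exact.
apply: definable_all => // i; apply: definable_lt => //; first exact: definable_cst.
by case: (dw i).
Qed.

End DefinableCk.

Section LocalSumOfSquares.
Variables (R : realType) (D : forall n : nat, set (set 'rV[R]_n)).
Hypothesis hD : ominimal_structure D.
Variables (n k : nat).

(** With E_ab = Q_ab - Q_ab(c) and d > 0,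
      E_ab y_a y_b = (d y_a + E_ab y_b / (2 d))^2 - d^2 y_a^2
                     - E_ab^2 y_b^2 / (4 d^2).
    The negative terms are absorbed by half of the definiteness margin e; the
    w_b are the coefficients of y_b^2 that are left.  They are returned because
    their positivity is what defines the neighbourhood. *)
Lemma local_sum_of_squares (Q : 'I_n -> 'I_n -> 'rV[R]_n -> R) (c : 'rV[R]_n) (e : R) :
  (forall a b, definable_Ck D k setT (Q a b)) -> 0 < e ->
  (forall v : 'I_n -> R, e * \sum_a v a ^+ 2 <= qform (fun a b => Q a b c) v) ->
  exists w : 'I_n -> 'rV[R]_n -> R,
    [/\ forall b, definable_Ck D k setT (w b), forall b, 0 < w b c &
      forall U, open U -> D U -> (forall x b, U x -> 0 < w b x) ->
      sum_of_squares_Ck D k U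
        (fun x => qform (fun a b => Q a b x) (fun a => x 0 a - c 0 a))].
Proof.
move=> dQ e0 Qe.
pose e2 := e / 2; have e20 : 0 < e2 by rewrite divr_gt0.
have e2e : e2 < e by rewrite gtr_pMr// invf_lt1// ltr1n.
have shift v : qform (fun a b => Q a b c - (if a == b then e2 else 0)) v =
    qform (fun a b => Q a b c) v - e2 * \sum_a v a ^+ 2.
  rewrite /qform mulr_sumr -sumrB; apply: eq_bigr => i _.
  rewrite (bigD1 i)//= [in RHS](bigD1 i)//= eqxx.
  rewrite (eq_bigr (fun j => v i * v j * Q i j c)); first by ring.
  by move=> j ji; rewrite eq_sym (negbTE ji) subr0.
have [|L HL] := @qform_sum_squares R n
    (fun a b => Q a b c - (if a == b then e2 else 0)).
  move=> v [a va].
  rewrite shift.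
  rewrite subr_gt0; apply: lt_le_trans (Qe v); rewrite ltr_pM2r//.
  rewrite (bigD1 a)//= ltr_pwDl//; first by rewrite exprn_even_gt0.
  by apply: sumr_ge0 => j _; rewrite sqr_ge0.
(* The terms d^2 y_a^2, each occurring n times, use up less than half of e2. *)
pose d2 := e2 / (2 * n.+1%:R); have d20 : 0 < d2 by rewrite divr_gt0// mulr_gt0.
pose d := Num.sqrt d2; have dd : d ^+ 2 = d2 by rewrite sqr_sqrtr// ltW.
have d0 : d != 0 by rewrite gt_eqF// sqrtr_gt0.
pose E a b x := Q a b x - Q a b c.
have dE a b : definable_Ck D k setT (E a b).
  by apply: definable_CkB => //; exact: definable_Ck_cst.
pose w b x := (e2 - n%:R * d2) - (4 * d2)^-1 * \sum_a E a b x * E a b x.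
have dw b : definable_Ck D k setT (w b).
  apply: definable_CkB => //; first exact: definable_Ck_cst.
  apply: definable_CkM => //; first exact: definable_Ck_cst.
  by apply: definable_Ck_sum => // a _; exact: definable_CkM.
exists w; split=> // [b|U oU DU wU].
  rewrite /w big1 => [|a _]; last by rewrite /E subrr mul0r.
  rewrite mulr0 subr0 subr_gt0 /d2 mulrCA gtr_pMr//.
  rewrite ltr_pdivrMr ?mulr_gt0// mul1r -natrM ltr_nat mul2n -addnn.
  by rewrite ltnS leq_addr.
have dy a : definable_Ck D k U (fun x => x 0 a - c 0 a).
  apply: definable_CkT => //; apply: definable_CkB => //.
    exact: definable_Ck_coord.
  exact: definable_Ck_cst.
have dyT a : definable_Ck D k setT (fun x : 'rV[R]_n => x 0 a - c 0 a).
  by apply: definable_CkB => //; [exact: definable_Ck_coord|exact: definable_Ck_cst].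
have sos1 : sum_of_squares_Ck D k U
    (fun x => \sum_r (\sum_a L r a * (x 0 a - c 0 a)) ^+ 2).
  apply: sum_of_squares_sum => r; apply: sum_of_squares_sqr.
  apply: definable_CkT => //; apply: definable_Ck_sum => // a _.
  by apply: definable_CkM => //; exact: definable_Ck_cst.
have sos2 : sum_of_squares_Ck D k U (fun x => \sum_a \sum_b
    (d * (x 0 a - c 0 a) + (2 * d)^-1 * (E a b x * (x 0 b - c 0 b))) ^+ 2).
  apply: sum_of_squares_sum => a; apply: sum_of_squares_sum => b.
  apply: sum_of_squares_sqr; apply: definable_CkT => //.
  apply: definable_CkD => //; apply: definable_CkM => //; do ?exact: definable_Ck_cst.
  exact: definable_CkM.
have sos3 : sum_of_squares_Ck D k U (fun x =>
    \sum_b (Num.sqrt (w b x) * (x 0 b - c 0 b)) ^+ 2).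
  apply: sum_of_squares_sum => b; apply: sum_of_squares_sqr.
  have [dws Cws] := definable_Ck_sqrt hD oU DU (fun x => wU x b) (dw b).
  have [_ Cy] := dy b.
  split; last exact: CkM.
  apply: definable_funW => //; apply: definable_mul => //.
    by apply: definable_sqrt => //; case: (dw b).
  by case: (dyT b).
have [N [q [dq qE]]] := sum_of_squaresD (sum_of_squaresD sos1 sos2) sos3.
exists N, q; split=> // x Ux; rewrite -qE//.
set y := fun a => x 0 a - c 0 a.
rewrite -(HL y) shift.
pose T := \sum_b y b ^+ 2 * \sum_a E a b x * E a b x.
have -> : \sum_a \sum_b (d * y a + (2 * d)^-1 * (E a b x * y b)) ^+ 2 =
    n%:R * d2 * \sum_a y a ^+ 2 + qform (fun a b => E a b x) y + (4 * d2)^-1 * T.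
  rewrite /T [(4 * d2)^-1 * _]mulr_sumr [X in _ + X](eq_bigr (fun b => \sum_a (4 * d2)^-1 *
    (y b ^+ 2 * (E a b x * E a b x)))) => [|b _]; last by rewrite !mulr_sumr.
  rewrite [X in _ + X]exchange_big /= mulr_sumr -!big_split /=; apply: eq_bigr => a _.
  rewrite (_ : n%:R * d2 * y a ^+ 2 = \sum_(b < n) d2 * y a ^+ 2); last first.
    by rewrite sumr_const card_ord -mulrA mulr_natl.
  rewrite -!big_split /=; apply: eq_bigr => b _.
  by rewrite -dd; field.
have -> : \sum_b (Num.sqrt (w b x) * y b) ^+ 2 =
    (e2 - n%:R * d2) * \sum_a y a ^+ 2 - (4 * d2)^-1 * T.
  rewrite /T !mulr_sumr -sumrB; apply: eq_bigr => b _.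
  by rewrite exprMn sqr_sqrtr ?ltW ?wU// /w; ring.
have -> : qform (fun a b => Q a b x) y =
    qform (fun a b => Q a b c) y + qform (fun a b => E a b x) y.
  rewrite /qform -big_split; apply: eq_bigr => a _.
  by rewrite -big_split; apply: eq_bigr => b _; rewrite /E /=; ring.
by ring.
Qed.

End LocalSumOfSquares.

(** * Lagrange multipliers *)

Section Multipliers.
Variable R : realType.

Lemma free_map_coef (V : vectType R) (T : eqType) (s : seq T) (v : T -> V) (c : T -> R) :
  free [seq v t | t <- s] -> \sum_(t <- s) c t *: v t = 0 ->
  forall t, t \in s -> c t = 0.
Proof.
move=> fv sum0 t ts.
have /freeP fP : free (map_tuple v (in_tuple s)) by [].
have its : (index t s < size s)%N by rewrite index_mem.
have := fP (fun i => c (tnth (in_tuple s) i)) _ (Ordinal its).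
rewrite (tnth_nth t) /= nth_index//; apply.
rewrite -[RHS]sum0 (big_tnth _ _ s); apply: eq_bigr => i _.
by rewrite (nth_map t)//= !(tnth_nth t).
Qed.

Lemma local_min_derive n (F : 'rV[R]_n -> R) (v x : 'rV[R]_n) :
  (forall y, derivable F y v) -> (\forall y \near x, F x <= F y) -> 'D_v F x = 0.
Proof.
move=> dF Fmin.
have /nbhs_ballP[d /= d0 Hd] : \forall s \near (0 : R), F x <= F (s *: v + x).
  exact: (@line_cvg _ _ x v _ Fmin).
pose phi (t : R) := F (t *: v + x).
have dphi t : derivable phi t 1.
  have [_ ] := is_derive_line F x v t ('D_v F (t *: v + x)).
  by have /(is_derive_line F x v t _)[] := derivableP (dF (t *: v + x)).
have := @derive1_at_min R phi (- d) d 0 _ (fun t _ => dphi t) _ _.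
rewrite in_itv /= oppr_lt0 d0 => /(_ _ isT) H.
have /(is_derive_line F x v 0 0) : is_derive (0 : R) (1 : R) phi 0.
  apply: H => [|t]; first by rewrite ge0_cp// ltW.
  rewrite in_itv /= -ltr_norml /phi scale0r add0r => td.
  by apply: Hd; rewrite /ball /= sub0r normrN.
by rewrite scale0r add0r => -[].
Qed.

(** Normalized coefficient vectors with sign and vanishing constraints form a
    compact set, on which the squared norm of the combination attains its
    infimum. *)
Lemma approximate_dependence (T : finType) n (W : T -> 'I_n -> R) (P Z : pred T) :
  (forall e, 0 < e -> exists z : T -> R,
     [/\ forall t, P t -> 0 <= z t, forall t, Z t -> z t = 0,
         \sum_t z t ^+ 2 = 1 & forall b, `|\sum_t z t * W t b| <= e]) ->
  exists z : T -> R,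
     [/\ forall t, P t -> 0 <= z t, forall t, Z t -> z t = 0,
         \sum_t z t ^+ 2 = 1 & forall b, \sum_t z t * W t b = 0].
Proof.
move=> approx.
pose N := #|T|.
have sumT (F : T -> R) : \sum_t F t = \sum_(i < N) F (enum_val i).
  by rewrite -big_enum_val.
pose K := [set z : 'rV[R]_N | [/\ forall i : 'I_N, P (enum_val i) -> 0 <= z 0 i,
  forall i : 'I_N, Z (enum_val i) -> z 0 i = 0 & \sum_i z 0 i ^+ 2 = 1]].
have oT := @openT ('rV[R]_N).
have Cx i : Ck 0 setT (fun z : 'rV[R]_N => z 0 i) := Ck_coord 0 i oT.
have Cc (r : R) : Ck 0 setT (fun z : 'rV[R]_N => r) := Ck_cst 0 r oT.
pose rho (z : 'rV[R]_N) := \sum_b (\sum_i z 0 i * W (enum_val i) b) ^+ 2.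
have crho : continuous rho.
  have C1 b : Ck 0 setT (fun z : 'rV[R]_N => \sum_i z 0 i * W (enum_val i) b) :=
    Ck_sum _ oT (fun i _ => CkM oT (Cx i) (Cc _)).
  exact: Ck_continuousT (Ck_sum _ oT (fun b _ => CkM oT (C1 b) (C1 b))).
have cK : compact K.
  have -> : K = (\bigcap_(i in [set i : 'I_N | P (enum_val i)]) [set z : 'rV[R]_N | 0 <= z 0 i])
      `&` (\bigcap_(i in [set i : 'I_N | Z (enum_val i)]) [set z : 'rV[R]_N | z 0 i = 0])
      `&` [set z : 'rV[R]_N | \sum_i z 0 i ^+ 2 = 1].
    apply/seteqP; split=> z /=; first by move=> [zP zZ z1]; split=> //; split.
    by move=> [[zP zZ] z1]; split.
  rewrite setIC; apply: compact_closedI; first exact: compact_unit_sphere.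
  apply: closedI.
  - apply: closed_bigI => i _.
    apply: (@closed_comp _ _ (fun z : 'rV[R]_N => z 0 i) [set r | 0 <= r]).
      by move=> z _; exact: coord_continuous.
    exact: closed_ge.
  - apply: closed_bigI => i _; apply: closed_level; exact: coord_continuous.
have rowK (z : T -> R) : [/\ forall t, P t -> 0 <= z t, forall t, Z t -> z t = 0 &
    \sum_t z t ^+ 2 = 1] -> K (\row_i z (enum_val i)).
  move=> [zP zZ z1]; split=> [i /zP|i /zZ|]; do ?by rewrite mxE.
  by rewrite -z1 sumT; apply: eq_bigr => i _; rewrite mxE.
have K0 : K !=set0.
  have [z [zP zZ z1 _]] := approx 1 ltr01.
  by exists (\row_i z (enum_val i)); exact: rowK.
have [z /set_mem[zP zZ z1] zmin] := EVT_min_rV K0 cK (continuous_subspaceT crho).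
have rho0 : rho z = 0.
  apply/eqP; rewrite eq_le sumr_ge0 ?andbT => [|b _]; last exact: sqr_ge0.
  rewrite leNgt; apply/negP => rz.
  (* n squares of size at most e^2 add up to less than rho z. *)
  pose e := Num.sqrt (rho z / n.+1%:R).
  have e0 : 0 < e by rewrite sqrtr_gt0 divr_gt0.
  have [y [yP yZ y1 yW]] := approx e e0.
  have /zmin : \row_i y (enum_val i) \in K by apply/mem_set; exact: rowK.
  rewrite leNgt => /negP; apply.
  apply: (@le_lt_trans _ _ (\sum_(b < n) e ^+ 2)).
    apply: ler_sum => b _.
    rewrite -[leLHS]real_normK ?num_real// ler_pXn2r ?nnegrE ?(ltW e0)//.
    apply: le_trans (yW b); rewrite sumT le_eqVlt; apply/orP; left; apply/eqP.
    by congr (`|_|); apply: eq_bigr => i _; rewrite mxE.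
  rewrite sumr_const card_ord /e sqr_sqrtr; last by rewrite divr_ge0// ltW.
  rewrite -[ltLHS]mulr_natl mulrCA gtr_pMr// ltr_pdivrMr// mul1r ltr_nat.
  exact: leqnn.
exists (fun t => z 0 (enum_rank t)); split=> [t Pt|t Zt||b].
- by apply: zP; rewrite enum_rankK.
- by apply: zZ; rewrite enum_rankK.
- by rewrite sumT -z1; apply: eq_bigr => i _; rewrite enum_valK.
rewrite sumT; under eq_bigr do rewrite enum_valK.
apply/eqP; rewrite -sqrf_eq0; apply/eqP.
exact: (psumr_eq0P (fun b _ => sqr_ge0 (\sum_i z 0 i * W (enum_val i) b)) rho0).
Qed.

End Multipliers.

Section KKT.
Variables (R : realType) (n l m : nat).
Variables (f : 'rV[R]_n -> R) (g : 'I_l -> 'rV[R]_n -> R) (h : 'I_m -> 'rV[R]_n -> R).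
Hypothesis Cf : Ck 1 setT f.
Hypothesis Cg : forall i, Ck 1 setT (g i).
Hypothesis Ch : forall j, Ck 1 setT (h j).
Variable xs : 'rV[R]_n.
Hypothesis xs_feasible : feasible_set g h xs.
Hypothesis xs_min : forall x, feasible_set g h x -> f xs <= f x.

Let sqdist (x : 'rV[R]_n) := \sum_b (x 0 b - xs 0 b) ^+ 2.

Let penalty x := \sum_i g i x * (g i x - `|g i x|) + \sum_j h j x ^+ 2.

(** The penalty vanishes exactly on the feasible set.  On the sphere of radius r
    around xs a large penalty keeps f - f xs + |x - xs|^2 + N penalty positive,
    whereas its value at xs is 0, so a minimizer x0 over the ball is interior.
    The penalty term of g_i is 0 where g_i >= 0 and 2 g_i^2 elsewhere; near x0
    it is bounded above, with equality at x0, by 2 g_i^2 if g_i(x0) <= 0 and by 0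
    otherwise.  Stationarity can therefore be read off the smooth function F1
    with these terms in place of the penalty. *)
Lemma penalized_stationary (r : R) : 0 < r -> exists x : 'rV[R]_n,
  (forall b, `|x 0 b - xs 0 b| <= r) /\
  exists (al : 'I_l -> R) (be : 'I_m -> R),
   [/\ forall i, 0 <= al i, forall i, 0 < g i x -> al i = 0 &
     forall b, partial b f x + 2 * (x 0 b - xs 0 b) =
       \sum_i al i * partial b (g i) x + \sum_j be j * partial b (h j) x].
Proof.
move=> r0; have oT := @openT 'rV[R]_n.
have Cc k (c : R) : Ck k setT (fun z : 'rV[R]_n => c) := Ck_cst k c oT.
have Cy b : Ck 1 setT (fun x : 'rV[R]_n => x 0 b - xs 0 b) :=
  CkB oT (Ck_coord 1 b oT) (Cc _ _).
have Cd : Ck 1 setT sqdist := Ck_sum _ oT (fun b _ => CkM oT (Cy b) (Cy b)).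
pose a x := f x - f xs + sqdist x.
have Ca : Ck 1 setT a := CkD oT (CkB oT Cf (Cc _ _)) Cd.
have ca := Ck_continuousT Ca.
have cd : continuous sqdist := Ck_continuousT Cd.
have term0 (t : R) : 0 <= t * (t - `|t|).
  have [t0|t0] := leP 0 t; first by rewrite ger0_norm// subrr mulr0.
  by rewrite mulr_le0// ?ltW// subr_lt0 (lt_le_trans t0).
have pen0 x : 0 <= penalty x.
  apply: addr_ge0; apply: sumr_ge0 => i _; [exact: term0|exact: sqr_ge0].
have Cpen : Ck 0 setT penalty.
  have cabs i : Ck 0 setT (fun x => `|g i x|).
    apply: Ck0 => x; apply: (@continuous_comp _ _ _ (g i) Num.norm).
      exact: Ck_continuousT (Cg i) x.
    exact: norm_continuous.
  have cg i : Ck 0 setT (g i) := CkW (Cg i).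
  have ch j : Ck 0 setT (h j) := CkW (Ch j).
  exact: (CkD oT (Ck_sum _ oT (fun i _ => CkM oT (cg i) (CkB oT (cg i) (cabs i))))
    (Ck_sum _ oT (fun j _ => CkM oT (ch j) (ch j)))).
have cpen := Ck_continuousT Cpen.
have pen_feasible x : penalty x = 0 -> feasible_set g h x.
  move=> /eqP; rewrite paddr_eq0; last first.
  - by apply: sumr_ge0 => j _; exact: sqr_ge0.
  - by apply: sumr_ge0 => i _; exact: term0.
  move=> /andP[/eqP p1 /eqP p2]; split=> [i|j].
    have : g i x * (g i x - `|g i x|) = 0.
      exact: (psumr_eq0P (fun i _ => term0 (g i x)) p1).
    have [//|gi /eqP] := leP 0 (g i x).
    rewrite ltr0_norm// opprK mulf_eq0 lt_eqF//= -mulr2n mulrn_eq0 /=.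
    by rewrite lt_eqF.
  apply/eqP; rewrite -sqrf_eq0; apply/eqP.
  exact: (psumr_eq0P (fun j _ => sqr_ge0 (h j x)) p2).
have box c x : sqdist x <= c ^+ 2 -> 0 <= c -> forall b, `|x 0 b - xs 0 b| <= c.
  move=> xc c0 b; rewrite -(@ler_pXn2r _ 2)// real_normK ?num_real//.
  apply: le_trans xc; rewrite /sqdist (bigD1 b)//= lerDl.
  by apply: sumr_ge0 => j _; rewrite sqr_ge0.
have compactd (S : set R) : closed S -> S `<=` [set c | c <= r ^+ 2] ->
    compact [set x | S (sqdist x)].
  move=> clS Sr; apply: (subclosed_compact _ (@compact_box _ _ xs r)).
    by apply: (@closed_comp _ _ sqdist S) => // x _; exact: cd.
  move=> x /Sr /= xr b; rewrite in_itv /= -ler_distl.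
  exact: (box r x xr (ltW r0)).
have cS : compact [set x | sqdist x = r ^+ 2].
  by apply: (compactd [set r ^+ 2]); [exact: closed_eq|move=> c ->/=].
have cB : compact [set x | sqdist x <= r ^+ 2].
  by apply: (compactd [set c | c <= r ^+ 2]); [exact: closed_le|].
have [|N HN] := compact_penalty cS ca cpen pen0.
  move=> x /= xr /pen_feasible/xs_min fx.
  by rewrite /a xr ltr_wpDl ?subr_ge0// exprn_gt0.
pose F0 x := a x + N%:R * penalty x.
have cF0 : continuous F0.
  exact: Ck_continuousT (CkD oT (CkW Ca) (CkM oT (Cc 0%N N%:R) Cpen)).
have sxs : sqdist xs = 0.
  by rewrite /sqdist big1// => b _; rewrite subrr expr0n.
have F0xs : F0 xs = 0.
  have [gxs hxs] := xs_feasible.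
  rewrite /F0 /a sxs subrr !add0r /penalty big1 => [|i _]; last first.
    by rewrite ger0_norm// subrr mulr0.
  by rewrite big1 ?addr0 ?mulr0// => j _; rewrite hxs expr0n.
have B0 : [set x | sqdist x <= r ^+ 2] !=set0.
  by exists xs; rewrite /= sxs sqr_ge0.
have [x0 /set_mem/= x0B x0min] := EVT_min_rV B0 cB (continuous_subspaceT cF0).
have x0r : sqdist x0 < r ^+ 2.
  rewrite lt_neqAle x0B andbT; apply/eqP => /HN.
  rewrite -/(F0 x0) ltNge => /negP; apply; rewrite -F0xs.
  by apply: x0min; apply/mem_set; rewrite /= sxs sqr_ge0.
exists x0; split; first by apply: box => //; exact: ltW.
pose F1 x := a x + N%:R * (\sum_(i | g i x0 <= 0) 2 * (g i x * g i x) + \sum_j h j x * h j x).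
have CF1 : Ck 1 setT F1 := CkD oT Ca (CkM oT (Cc _ _) (CkD oT
    (Ck_sum _ oT (fun i _ => CkM oT (Cc _ _) (CkM oT (Cg i) (Cg i))))
    (Ck_sum _ oT (fun j _ => CkM oT (Ch j) (Ch j))))).
have F1min : \forall x \near x0, F1 x0 <= F1 x.
  have near_pos := near_positive x0 (fun i => Ck_continuousT (Cg i)).
  have near_in : \forall x \near x0, sqdist x < r ^+ 2.
    exact: (cvgr_lt _ (cd x0) _ x0r).
  have F01 : F1 x0 = F0 x0.
    rewrite /F1 /F0 /penalty; congr (_ + _ * (_ + _)).
    rewrite big_mkcond; apply: eq_bigr => i _; case: ifPn => [gi|].
      by rewrite ler0_norm// opprK; ring.
    by rewrite -ltNge => gi; rewrite gtr0_norm// subrr mulr0.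
  apply: filterS2 near_pos near_in => x xpos xr.
  rewrite F01; apply: le_trans (x0min x _) _; first by apply/mem_set; exact: ltW.
  rewrite /F0 /F1 lerD2l ler_wpM2l// lerD2r /penalty [leRHS]big_mkcond.
  apply: ler_sum => i _; case: ifPn => [gi|].
    have [t0|t0] := leP 0 (g i x).
      by rewrite ger0_norm// subrr mulr0 !mulr_ge0.
    by rewrite ltr0_norm// opprK le_eqVlt; apply/orP; left; apply/eqP; ring.
  by rewrite -ltNge => /xpos gi; rewrite gtr0_norm// subrr mulr0.
exists (fun i => if g i x0 <= 0 then - (4 * N%:R * g i x0) else 0),
  (fun j => - (2 * N%:R * h j x0)); split=> [i|i gi|b].
- by case: ifPn => // gi; rewrite -mulrN mulr_ge0 ?oppr_ge0// mulr_ge0.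
- by rewrite leNgt gi.
have dF1 y : derivable F1 y (delta_mx 0 b) by exact: (@Ck_derivable _ _ 0 setT F1 b y CF1 I).
have {}dF1 := local_min_derive dF1 F1min.
pose d1 := partial b f x0 + 2 * (x0 0 b - xs 0 b) +
  N%:R * (\sum_(i | g i x0 <= 0) 2 * (2 * (g i x0 * partial b (g i) x0)) +
  \sum_j 2 * (h j x0 * partial b (h j) x0)).
have : is_derive x0 (delta_mx 0 b) F1 d1.
  have dy c : is_derive x0 (delta_mx 0 b) (fun x : 'rV[R]_n => x 0 c - xs 0 c)
      ((delta_mx 0 b : 'rV[R]_n) 0 c - 0).
    apply: is_deriveB; exact: is_derive_coord.
  have dsq := is_derive_bigsum (index_enum _) xpredT (fun c => is_deriveM (dy c) (dy c)).
  have df : is_derive x0 (delta_mx 0 b) f (partial b f x0) := Ck_is_derive b Cf I.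
  have dg i : is_derive x0 (delta_mx 0 b) (g i) (partial b (g i) x0) :=
    Ck_is_derive b (Cg i) I.
  have dh i : is_derive x0 (delta_mx 0 b) (h i) (partial b (h i) x0) :=
    Ck_is_derive b (Ch i) I.
  have dsg := is_derive_bigsum (index_enum _) (fun i => g i x0 <= 0)
    (fun i => is_deriveZ 2 (is_deriveM (dg i) (dg i))).
  have dsh := is_derive_bigsum (index_enum _) xpredT
    (fun j => is_deriveM (dh j) (dh j)).
  have dF := is_deriveD (is_deriveD (is_deriveB df (is_derive_cst (f xs) x0 _)) dsq)
    (is_deriveZ N%:R (is_deriveD dsg dsh)).
  apply: (is_derive_eq dF); rewrite /d1 subr0; congr (_ + _ + _).
    rewrite (bigD1 b)//= big1 => [|c cb]; rewrite mxE eqxx /= ?eqxx.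
      rewrite /GRing.scale /=. ring.
    by rewrite (negbTE cb) subr0 scaler0 addr0.
  rewrite [_ *: _]/(_ * _); congr (_ * (_ + _)).
    by apply: eq_bigr => i _; rewrite /GRing.scale /=; ring.
  by apply: eq_bigr => i _; rewrite /GRing.scale /=; ring.
move=> [_]; rewrite dF1 /d1 => /esym/eqP; rewrite addr_eq0 => /eqP ->.
rewrite mulrDr opprD; congr (_ + _).
  rewrite mulr_sumr -sumrN big_mkcond; apply: eq_bigr => i _.
  by case: ifP => _; ring.
by rewrite mulr_sumr -sumrN; apply: eq_bigr => i _; ring.
Qed.


Lemma regular_coef (al : 'I_l -> R) (be : 'I_m -> R) : regular_at g h xs ->
  (forall i, 0 < g i xs -> al i = 0) ->
  (forall b, \sum_i al i * partial b (g i) xs + \sum_j be j * partial b (h j) xs = 0) ->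
  (forall i, al i = 0) /\ (forall j, be j = 0).
Proof.
move=> reg al0 sum0.
pose v (t : 'I_l + 'I_m) := match t with inl i => grad (g i) xs | inr j => grad (h j) xs end.
pose c (t : 'I_l + 'I_m) := match t with inl i => al i | inr j => be j end.
pose s : seq ('I_l + 'I_m) := [seq inl i | i in active g xs] ++ [seq inr j | j : 'I_m].
have fv : free [seq v t | t <- s] by rewrite map_cat -map_comp -[X in _ ++ X]map_comp.
have act i : ~~ active g xs i -> al i = 0.
  by move=> gi; apply: al0; rewrite lt_neqAle eq_sym gi (xs_feasible.1 i).
have csum : \sum_(t <- s) c t *: v t = 0.
  apply/rowP => b; rewrite big_cat /= !big_map !big_enum_cond/= !mxE !summxE -[RHS](sum0 b).
  congr (_ + _); last by apply: eq_bigr => j _; rewrite !mxE.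
  rewrite [RHS](bigID (active g xs)) /= [X in _ = _ + X]big1 ?addr0.
    by apply: eq_big => [i|i _]; rewrite ?andbT// !mxE.
  by move=> i /act ->; rewrite mul0r.
have c0 := free_map_coef fv csum; split=> [i|j].
  have [ai|/act//] := boolP (active g xs i); apply: (c0 (inl i)).
  by rewrite mem_cat map_f// mem_enum.
by apply: (c0 (inr j)); rewrite mem_cat orbC map_f// mem_enum.
Qed.

(** The multipliers (1, al, be) of [penalized_stationary] on balls of radius
    tending to 0, scaled to norm 1, are approximate linear relations between the
    gradients at xs.  In the exact relation z that they yield, z_f = 0 would
    contradict regularity, and dividing by z_f gives lam and nu. *)
Lemma KKT_exists : regular_at g h xs -> exists lam nu, KKT f g h xs lam nu.
Proof.
move=> reg; have [gxs hxs] := xs_feasible.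
pose T : finType := ('I_1 + ('I_l + 'I_m))%type.
(* With these signs the relations that satisfy the sign constraints P and in
   which f occurs are, up to scaling, the KKT equations. *)
pose grd (t : T) (x : 'rV[R]_n) (b : 'I_n) : R := match t with
  | inl _ => partial b f x
  | inr (inl i) => - partial b (g i) x
  | inr (inr j) => - partial b (h j) x
  end.
pose P (t : T) := if t is inr (inr _) then false else true.
pose Z (t : T) := if t is inr (inl i) then 0 < g i xs else false.
have sumT (F : T -> R) : \sum_t F t =
    F (inl 0) + (\sum_i F (inr (inl i)) + \sum_j F (inr (inr j))).
  by rewrite !big_sumType /= big_ord1.
have [z [zP zZ z1 zW]] : exists z : T -> R,
   [/\ forall t, P t -> 0 <= z t, forall t, Z t -> z t = 0,
     \sum_t z t ^+ 2 = 1 & forall b, \sum_t z t * grd t xs b = 0].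
  apply: approximate_dependence => e e0.
  pose dev b (x : 'rV[R]_n) := \sum_t `|grd t xs b - grd t x b| + 2 * `|x 0 b - xs 0 b|.
  have cdev b : continuous (dev b).
    have cabs (u : 'rV[R]_n -> R) : continuous u -> Ck 0 setT (fun x => `|u x|).
      move=> cu; apply: Ck0 => x; apply: (@continuous_comp _ _ _ u Num.norm); first exact: cu.
      exact: norm_continuous.
    have oT := @openT 'rV[R]_n.
    have cgrd t : Ck 0 setT (fun x => grd t x b).
      case: t => [_|[i|j]] /=; first exact: (Ck_partial b Cf).
        exact: (CkN oT (Ck_partial b (Cg i))).
      exact: (CkN oT (Ck_partial b (Ch j))).
    have c1 t : continuous (fun x => grd t xs b - grd t x b).
      exact: Ck_continuousT (CkB oT (Ck_cst _ _ oT) (cgrd t)).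
    have c2 : continuous (fun x : 'rV[R]_n => x 0 b - xs 0 b).
      exact: Ck_continuousT (CkB oT (Ck_coord 0 b oT) (Ck_cst _ _ oT)).
    exact: Ck_continuousT (CkD oT (Ck_sum _ oT (fun t _ => cabs _ (c1 t)))
      (CkM oT (Ck_cst _ _ oT) (cabs _ c2))).
  have dev0 b : dev b xs = 0.
    by rewrite /dev subrr normr0 mulr0 addr0 big1// => t _; rewrite subrr normr0.
  have near_dev : \forall x \near xs, forall b, dev b x < e.
    apply: (@filter_forall _ _ (fun b x => dev b x < e) _ (nbhs_filter xs)) => b.
    by apply: (cvgr_lt _ (cdev b xs)); rewrite dev0.
  have near_pos := near_positive xs (fun i => Ck_continuousT (Cg i)).
  have : \forall x \near xs, (forall b, dev b x < e) /\ forall i, 0 < g i xs -> 0 < g i x.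
    by apply: filterS2 near_dev near_pos.
  move=> /nbhs_ballP[r /= r0 Hr].
  (* The stationary point may lie at distance exactly the given radius. *)
  have r20 : 0 < r / 2 by rewrite divr_gt0.
  have [x [xr [al [be [al0 alZ stat]]]]] := penalized_stationary r20.
  have [devx posx] : (forall b, dev b x < e) /\ forall i, 0 < g i xs -> 0 < g i x.
    apply: Hr; split=> // i b; rewrite (ord1 i) /ball /= distrC.
    by apply: le_lt_trans (xr b) _; rewrite gtr_pMr// invf_lt1// ltr1n.
  pose S := 1 + (\sum_i al i ^+ 2 + \sum_j be j ^+ 2).
  have S1 : 1 <= S.
    by rewrite lerDl addr_ge0// sumr_ge0// => i _; rewrite sqr_ge0.
  have S0 : 0 < S := lt_le_trans ltr01 S1.
  pose s := (Num.sqrt S)^-1.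
  have s0 : 0 < s by rewrite invr_gt0 sqrtr_gt0.
  have s2 : s ^+ 2 * S = 1 by rewrite exprVn sqr_sqrtr ?mulVf ?gt_eqF// ltW.
  pose c (t : T) := match t with inl _ => 1 | inr (inl i) => al i | inr (inr j) => be j end.
  have z1 : \sum_t (s * c t) ^+ 2 = 1.
    by under eq_bigr do rewrite exprMn; rewrite -mulr_sumr sumT expr1n.
  exists (fun t => s * c t); split=> //.
  - move=> [_|[i|//]] _ /=; first by rewrite mulr1 ltW.
    by rewrite mulr_ge0// ltW.
  - by move=> [//|[i|//]] /= /posx/alZ ->; rewrite mulr0.
  move=> b; have statT : \sum_t c t * grd t x b = - (2 * (x 0 b - xs 0 b)).
    rewrite sumT /= mul1r.
    under [X in _ + (X + _)]eq_bigr do rewrite mulrN.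
    under [X in _ + (_ + X)]eq_bigr do rewrite mulrN.
    by rewrite !sumrN -opprD -stat; ring.
  have -> : \sum_t s * c t * grd t xs b =
      \sum_t s * c t * (grd t xs b - grd t x b) - s * (2 * (x 0 b - xs 0 b)).
    rewrite -mulrN -statT mulr_sumr -big_split; apply: eq_bigr => t _ /=.
    by ring.
  have sc1 t : `|s * c t| <= 1.
    rewrite -(@ler_pXn2r _ 2)// ?nnegrE// expr1n real_normK ?num_real// -z1.
    rewrite (bigD1 t)//= lerDl; apply: sumr_ge0 => t' _; exact: sqr_ge0.
  apply: le_trans (ltW (devx b)); apply: le_trans (ler_normB _ _) _; apply: lerD.
    apply: le_trans (ler_norm_sum _ _ _) _; apply: ler_sum => t _.
    by rewrite normrM ler_piMl.
  rewrite normrM normrM (ger0_norm (ltW s0)) (ger0_norm (ler0n _ 2)).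
  have /= := sc1 (inl 0); rewrite mulr1 => s1.
  by rewrite ler_piMl ?mulr_ge0//; apply: le_trans s1; exact: ler_norm.
have zf0 : 0 <= z (inl 0) by exact: zP.
have [zf|zf] := eqVneq (z (inl 0)) 0.
  have [|b|z_al z_be] := @regular_coef (fun i => z (inr (inl i)))
      (fun j => z (inr (inr j))) reg.
  - by move=> i gi; exact: zZ.
  - have := zW b; rewrite sumT zf mul0r add0r /=.
    under [X in X + _]eq_bigr do rewrite mulrN.
    under [X in _ + X]eq_bigr do rewrite mulrN.
    by rewrite !sumrN -opprD => /eqP; rewrite oppr_eq0 => /eqP.
  move: z1; rewrite sumT zf expr0n add0r !big1 ?addr0 => [/esym/eqP|j _|i _].
  - by rewrite oner_eq0.
  - by rewrite z_be expr0n.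
  - by rewrite z_al expr0n.
exists (fun i => z (inr (inl i)) / z (inl 0)), (fun j => z (inr (inr j)) / z (inl 0)).
split=> [|i|i].
- apply/rowP => b; rewrite !mxE !summxE.
  under eq_bigr do rewrite !mxE.
  under [X in _ - X]eq_bigr do rewrite !mxE.
  have := zW b; rewrite sumT /=.
  under [X in _ + (X + _)]eq_bigr do rewrite mulrN.
  under [X in _ + (_ + X)]eq_bigr do rewrite mulrN.
  rewrite !sumrN => H.
  apply: (mulfI zf); rewrite mulr0 -[RHS]H !mulrBr !mulr_sumr -addrA -!sumrN.
  by congr (_ + (_ + _)); apply: eq_bigr => i _; field.
- have [gi|gi] := ltP 0 (g i xs); first by rewrite (zZ (inr (inl i)))// !mul0r.
  have -> : g i xs = 0 by apply/eqP; rewrite eq_le gi gxs.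
  by rewrite mulr0.
- by rewrite divr_ge0//; exact: zP.
Qed.

End KKT.

(** * Second-order expansion at a critical zero *)

Section SecondOrder.
Variables (R : realType) (n : nat).
Implicit Types (F : 'rV[R]_n -> R) (c x : 'rV[R]_n).

(** Where the first factor vanishes, a product is differentiable even if the
    second factor is merely continuous. *)
Lemma is_derive_vanishing_mul (r : 'rV[R]_n -> R) c (a b : 'I_n) :
  {for c, continuous r} ->
  is_derive c (delta_mx 0 b) (fun x => (x 0 a - c 0 a) * r x) ((a == b)%:R * r c).
Proof.
move=> cr.
set g := fun x => _ * _.
suff lim : (fun h => h^-1 *: ((g \o shift c) (h *: delta_mx 0 b) - g c)) @ (0 : R)^' -->
    (a == b)%:R * r c.
  by apply: DeriveDef; [apply/cvg_ex; eexists; exact: lim|exact/cvg_lim].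
have lim0 : (fun s : R => (a == b)%:R * r (s *: delta_mx 0 b + c)) @ (0 : R)^' -->
    (a == b)%:R * r c.
  by apply: cvgMl_tmp; apply: cvg_within_filter; exact: (cvg_comp _ _ (@line_cvg _ _ c _) cr).
apply: cvg_trans lim0; apply: near_eq_cvg; near=> h.
have h0 : h != 0 by near: h; exact: nbhs_dnbhs_neq.
rewrite /g /= subrr mul0r subr0 /GRing.scale /= !mxE eqxx /= addrK.
by rewrite !mulrA mulVf// mul1r.
Unshelve. all: by end_near. Qed.

Lemma is_derive_vanishing_sum (q : 'I_n -> 'rV[R]_n -> R) c b :
  (forall a, continuous (q a)) ->
  is_derive c (delta_mx 0 b) (fun x => \sum_a (x 0 a - c 0 a) * q a x) (q b c).
Proof.
move=> cq.
have dS := is_derive_bigsum (index_enum _) xpredT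
  (fun a => is_derive_vanishing_mul (r := q a) (c := c) a b (cq a c)).
apply: (is_derive_eq dS); rewrite (bigD1 b)//= eqxx mul1r big1 ?addr0// => a ab.
by rewrite (negbTE ab) mul0r.
Qed.

Lemma hadamard_partial F (q : 'I_n -> 'rV[R]_n -> R) c (r : R) b :
  (forall a, continuous (q a)) ->
  (forall x, F x = r + \sum_a (x 0 a - c 0 a) * q a x) -> q b c = partial b F c.
Proof.
move=> cq FE.
have := is_deriveD (is_derive_cst r c (delta_mx 0 b)) (is_derive_vanishing_sum c b cq).
rewrite add0r /partial (_ : cst r + _ = F) => [[_ ->]//|].
by apply/funext => x; rewrite FE.
Qed.

(** Differentiating F = sum_a y_a q_a twice at the point where y vanishes: a factor
    y_a that is not differentiated kills its term, even where q_a is only C^1. *)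
Lemma hadamard_hessian F (q : 'I_n -> 'rV[R]_n -> R)
    (Q : 'I_n -> 'I_n -> 'rV[R]_n -> R) c a b :
  (forall a, Ck 1 setT (q a)) -> (forall a b, continuous (Q a b)) ->
  (forall x, F x = \sum_a (x 0 a - c 0 a) * q a x) ->
  (forall a x, q a x = \sum_b (x 0 b - c 0 b) * Q a b x) ->
  partial b (partial a F) c = Q a b c + Q b a c.
Proof.
move=> Cq cQ FE qE.
have pE x : partial a F x = q a x + \sum_d (x 0 d - c 0 d) * partial a (q d) x.
  have dy d : is_derive x (delta_mx 0 a) (fun x : 'rV[R]_n => x 0 d - c 0 d)
      ((delta_mx 0 a : 'rV[R]_n) 0 d - 0).
    by apply: is_deriveB; exact: is_derive_coord.
  have dq d : is_derive x (delta_mx 0 a) (q d) (partial a (q d) x) := Ck_is_derive a (Cq d) I.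
  have [_ dF] : is_derive x (delta_mx 0 a) F (\sum_d
      ((x 0 d - c 0 d) * partial a (q d) x + q d x * ((delta_mx 0 a : 'rV[R]_n) 0 d - 0))).
    rewrite (funext FE).
    exact: (is_derive_bigsum (index_enum _) xpredT (fun d => is_deriveM (dy d) (dq d))).
  rewrite [LHS]dF big_split /= addrC; congr (_ + _).
  rewrite (bigD1 a)//= mxE !eqxx /= big1 => [|d da]; first by rewrite subr0 mulr1 addr0.
  by rewrite mxE eqxx (negbTE da) subr0 mulr0.
have cp d : continuous (partial a (q d)) := Ck_continuousT (Ck_partial a (Cq d)).
have dq : is_derive c (delta_mx 0 b) (q a) (Q a b c).
  by rewrite (funext (qE a)); exact: is_derive_vanishing_sum.
have [_ dE] := is_deriveD dq (is_derive_vanishing_sum c b cp).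
rewrite (funext pE) [LHS]dE; congr (_ + _).
by apply/esym/(hadamard_partial (r := 0)) => // x; rewrite add0r.
Qed.

End SecondOrder.

Section LocalRepresentation.
Variables (R : realType) (D : forall n : nat, set (set 'rV[R]_n)).
Hypothesis hD : ominimal_structure D.

Lemma mulmx_tr_eq0 n (v w : 'rV[R]_n) :
  \sum_a v 0 a * w 0 a = 0 -> v *m w^T = 0.
Proof.
move=> vw; apply/matrixP => i j; rewrite !ord1 !mxE -[RHS]vw.
by apply: eq_bigr => a _; rewrite mxE.
Qed.

Lemma quadratic_mxE n (v : 'rV[R]_n) (A : 'M[R]_n) :
  (v *m A *m v^T) 0 0 = qform (fun a b => A a b) (fun a => v 0 a).
Proof.
rewrite /qform exchange_big mxE; apply: eq_bigr => b _ /=.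
rewrite !mxE mulr_suml; apply: eq_bigr => a _.
by rewrite mulrAC.
Qed.

(** The first-order Hadamard factors G_j of u_j take at c the value of the
    gradient of u_j, so L + N sum_j u_j^2 has the quadratic coefficients
    Q_ab + N sum_j G_ja G_jb, which [finsler] makes positive definite at c. *)
Lemma local_sum_of_squares_of_hessian n k (L : 'rV[R]_n -> R) (J : finType)
    (u : J -> 'rV[R]_n -> R) (c : 'rV[R]_n) :
  definable_Ck D k.+2 setT L -> (forall j, definable_Ck D k.+1 setT (u j)) ->
  L c = 0 -> (forall a, partial a L c = 0) -> (forall j, u j c = 0) ->
  (forall v : 'rV[R]_n, v != 0 -> (forall j, v *m (grad (u j) c)^T = 0) ->
     0 < (v *m hessian L c *m v^T) 0 0) ->
  exists (N : nat) (w : 'I_n -> 'rV[R]_n -> R),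
    [/\ forall b, definable_Ck D k setT (w b), forall b, 0 < w b c &
      forall U, open U -> D U -> (forall x b, U x -> 0 < w b x) ->
      sum_of_squares_Ck D k U (fun x => L x + N%:R * \sum_j u j x ^+ 2)].
Proof.
move=> dL du L0 gradL0 u0 hess.
have [q [dq LE]] := definable_hadamard c hD dL.
have cq a : continuous (q a) by case: (dq a) => _ /Ck_continuousT.
have q0 a : q a c = 0 by rewrite (hadamard_partial a cq LE) gradL0.
rewrite L0 in LE; have {}LE x : L x = \sum_a (x 0 a - c 0 a) * q a x.
  by rewrite LE add0r.
have [Q dQE] := boolp.choice (fun a => definable_hadamard c hD (dq a)).
have dQ a b : definable_Ck D k setT (Q a b) by case: (dQE a).
have qE a x : q a x = \sum_b (x 0 b - c 0 b) * Q a b x.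
  by case: (dQE a) => _ ->; rewrite q0 add0r.
have cQ a b : continuous (Q a b) by case: (dQ a b) => _ /Ck_continuousT.
have [G dGE] := boolp.choice (fun j => definable_hadamard c hD (du j)).
have dG j b : definable_Ck D k setT (G j b) by case: (dGE j).
have cG j b : continuous (G j b) by case: (dG j b) => _ /Ck_continuousT.
have uE j x : u j x = \sum_b (x 0 b - c 0 b) * G j b x.
  by case: (dGE j) => _ ->; rewrite u0 add0r.
have Gc j b : G j b c = partial b (u j) c.
  by apply: (hadamard_partial (r := 0)) => // x; rewrite uE add0r.
have [|N [e e0 Ne]] := @finsler R n J (fun a b => Q a b c) (fun j b => G j b c).
  move=> v [a va] vG.
  have := hess (\row_a v a); rewrite quadratic_mxE.
  have -> : qform (fun a b => hessian L c a b) (fun a => (\row_a v a) 0 a) =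
      2 * qform (fun a b => Q a b c) v.
    rewrite mulr_natl mulr2n {2}/qform exchange_big -big_split; apply: eq_bigr => i _.
    rewrite -big_split; apply: eq_bigr => j _; rewrite !mxE.
    rewrite (@hadamard_hessian _ _ L q Q c j i)//=; first by ring.
    by move=> d; case: (dq d) => _; exact: (@Ck_le _ _ 1 k.+1).
  rewrite pmulr_rgt0//; apply.
    by apply: contra_neq va => /rowP/(_ a); rewrite !mxE.
  move=> j; apply: mulmx_tr_eq0; rewrite -[RHS](vG j); apply: eq_bigr => b _.
  by rewrite !mxE Gc.
pose Qt a b x := Q a b x + N%:R * \sum_j G j a x * G j b x.
have dQt a b : definable_Ck D k setT (Qt a b).
  apply: definable_CkD => //; apply: definable_CkM => //; first exact: definable_Ck_cst.
  apply: definable_Ck_sum => // j _.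
  by apply: definable_CkM => //; apply: definable_Ck_le (dG j _).
have QtE x v : qform (fun a b => Qt a b x) v =
    qform (fun a b => Q a b x) v + N%:R * \sum_j (\sum_a v a * G j a x) ^+ 2.
  rewrite /Qt /qform mulr_sumr.
  under [X in _ = _ + X]eq_bigr => j _.
    rewrite expr2 mulr_suml mulr_sumr.
    under eq_bigr do rewrite !mulr_sumr.
    over.
  rewrite [X in _ = _ + X]exchange_big -big_split; apply: eq_bigr => a _ /=.
  rewrite [X in _ = _ + X]exchange_big -big_split; apply: eq_bigr => b _ /=.
  rewrite mulrDr; congr (_ + _); rewrite !mulr_sumr; apply: eq_bigr => j _.
  by ring.
have [|w [dw w0 wsos]] := local_sum_of_squares hD (c := c) dQt e0.
  by move=> v; rewrite QtE; exact: Ne.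
exists N, w; split=> // U oU DU wU.
have [M [r [dr rE]]] := wsos U oU DU wU.
exists M, r; split=> // x Ux; rewrite -rE// QtE.
congr (_ + _ * _); last by apply: eq_bigr => j _; rewrite uE.
rewrite LE /qform; apply: eq_bigr => a _; rewrite qE mulr_sumr.
by apply: eq_bigr => b _; rewrite mulrA.
Qed.

End LocalRepresentation.

(** * The local representation *)

Theorem theorem3p1 (R : realType) (D : forall n : nat, set (set 'rV[R]_n))
    (hD : ominimal_structure D) (p n l m : nat) (hp : (2 <= p)%N)
    (f : 'rV[R]_n -> R) (g : 'I_l -> 'rV[R]_n -> R)
    (h : 'I_m -> 'rV[R]_n -> R)
    (hf : definable_Ck D p setT f)
    (hg : forall i, definable_Ck D p setT (g i))
    (hh : forall j, definable_Ck D p setT (h j))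
    (hS : feasible_set g h !=set0)
    (hpos : forall x, feasible_set g h x -> 0 <= f x)
    (xs : 'rV[R]_n) (hxs : feasible_set g h xs) (hfxs : f xs = 0)
    (hreg : regular_at g h xs)
    (hsc : strict_complementarity f g h xs)
    (hso : second_order_sufficiency f g h xs) :
  exists (U : set 'rV[R]_n) (phi : 'I_l.+1 -> 'rV[R]_n -> R)
         (psi : 'I_m -> 'rV[R]_n -> R),
    [/\ open U, U xs & D n U] /\
    [/\ forall i, definable_Ck D (p - 2) U (phi i),
        forall i, sum_of_squares_Ck D (p - 2) U (phi i),
        forall j, definable_Ck D (p - 2) U (psi j) &
        forall x, U x ->
          f x = phi ord0 x + \sum_(i < l) phi (lift ord0 i) x * g i x
                + \sum_(j < m) psi j x * h j x].
Proof.
have {p hp hf hg hh} [k [-> [df [dg dh]]]] : exists k, (p - 2 = k)%N /\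
    (definable_Ck D k.+2 setT f /\ (forall i, definable_Ck D k.+2 setT (g i)) /\
     (forall j, definable_Ck D k.+2 setT (h j))).
  exists (p - 2)%N; have -> : (p - 2).+2 = p by rewrite -addn2 subnK.
  by [].
have toC1 (u : 'rV[R]_n -> R) : definable_Ck D k.+2 setT u -> Ck 1 setT u.
  by move=> [_]; exact: (@Ck_le _ _ 1 k.+2).
have toC (u : 'rV[R]_n -> R) : definable_Ck D k.+2 setT u ->
    definable_Ck D k.+1 setT u := definable_Ck_le (leqnSn k.+1).
have toC0 (u : 'rV[R]_n -> R) : definable_Ck D k.+1 setT u ->
    definable_Ck D k setT u := definable_Ck_le (leqnSn k).
have [gxs hxs'] := hxs.
have fmin x : feasible_set g h x -> f xs <= f x by rewrite hfxs; exact: hpos.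
have [lam [nu kkt]] := KKT_exists (toC1 _ df) (fun i => toC1 _ (dg i))
  (fun j => toC1 _ (dh j)) hxs fmin hreg.
have [grad0 slack lam0] := kkt.
pose act := active g xs.
have inact i : ~~ act i -> lam i = 0.
  by move=> gi; have /eqP := slack i; rewrite mulf_eq0 => /orP[/eqP//|]; move/negP: gi.
pose L := lagrangian f g h xs lam nu.
have dL : definable_Ck D k.+2 setT L :=
  definable_CkB hD (definable_CkB hD df (definable_Ck_sum hD _
    (fun i _ => definable_CkM hD (definable_Ck_cst hD _ _ (lam i)) (dg i))))
    (definable_Ck_sum hD _
    (fun j _ => definable_CkM hD (definable_Ck_cst hD _ _ (nu j)) (dh j))).
have L0 : L xs = 0.
  rewrite /L /lagrangian hfxs big1 => [|i /eqP ->]; last by rewrite mulr0.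
  by rewrite big1 ?subr0// => j _; rewrite hxs' mulr0.
have gradL a : partial a L xs = 0.
  have ds u : Ck 1 setT u -> is_derive xs (delta_mx 0 a) u (partial a u xs).
    by move=> Cu; exact: (@Ck_is_derive _ _ 0 setT u a xs Cu I).
  have dsg := is_derive_bigsum (index_enum _) act
    (fun i => is_deriveZ (lam i) (ds _ (toC1 _ (dg i)))).
  have dsh := is_derive_bigsum (index_enum _) xpredT
    (fun j => is_deriveZ (nu j) (ds _ (toC1 _ (dh j)))).
  have [_ LE] := is_deriveB (is_deriveB (ds _ (toC1 _ df)) dsg) dsh.
  have /rowP/(_ a) := grad0; rewrite !mxE !summxE => grad0a.
  rewrite [LHS]LE -[RHS]grad0a.
  congr (_ - _ - _); last by apply: eq_bigr => j _; rewrite !mxE.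
  rewrite [RHS](bigID act) /= [X in _ = _ + X]big1 => [|i /inact ->].
    by rewrite addr0; apply: eq_bigr => i _; rewrite !mxE.
  by rewrite scale0r mxE.
pose u (t : 'I_l + 'I_m) := match t with
  | inl i => if act i then g i else fun=> 0
  | inr j => h j
  end.
have du t : definable_Ck D k.+1 setT (u t).
  case: t => [i|j] /=; last exact: toC (dh j).
  by case: (act i); [exact: toC (dg i)|exact: definable_Ck_cst].
have u0 t : u t xs = 0.
  by case: t => [i|j] /=; [case: ifP => // /eqP|exact: hxs'].
have hess (v : 'rV[R]_n) : v != 0 -> (forall t, v *m (grad (u t) xs)^T = 0) ->
    0 < (v *m hessian L xs *m v^T) 0 0.
  move=> v0 vu; apply: (hso lam nu kkt) => //; split=> [i ai|j].
    by have := vu (inl i); rewrite /= /act ai.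
  exact: (vu (inr j)).
have [N [w [dw w0 wsos]]] := local_sum_of_squares_of_hessian hD dL du L0 gradL u0 hess.
(* U is where all W t are positive; inactive constraints impose nothing. *)
pose W (t : 'I_n + 'I_l) := match t with
  | inl b => w b
  | inr i => if act i then (fun x => lam i - N%:R * g i x) else fun=> 1
  end.
have dsig i : definable_Ck D k setT (fun x => lam i - N%:R * g i x) :=
  definable_CkB hD (definable_Ck_cst hD _ _ _)
    (definable_CkM hD (definable_Ck_cst hD _ _ _) (toC0 _ (toC _ (dg i)))).
have dW t : definable_Ck D k setT (W t).
  case: t => [b|i] /=; first exact: dw.
  by case: (act i); [exact: dsig|exact: definable_Ck_cst].
have [oU DU] := definable_open_pos hD dW.
set U := [set x | _] in oU DU.
have sumu x : \sum_t u t x ^+ 2 = \sum_(i | act i) g i x ^+ 2 + \sum_j h j x ^+ 2.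
  rewrite big_sumType /=; congr (_ + _); rewrite [RHS]big_mkcond.
  by apply: eq_bigr => i _; case: (act i); rewrite ?expr0n.
have dsum : definable_Ck D k setT (fun x => L x + N%:R * \sum_t u t x ^+ 2) :=
  definable_CkD hD (toC0 _ (toC _ dL))
    (definable_CkM hD (definable_Ck_cst hD _ _ _) (definable_Ck_sum hD _
      (fun t _ => definable_CkM hD (toC0 _ (du t)) (toC0 _ (du t))))).
exists U, (fun i => match unlift ord0 i with
    | None => fun x => L x + N%:R * \sum_t u t x ^+ 2
    | Some i => if act i then fun x => lam i - N%:R * g i x else fun=> 0
    end), (fun j x => nu j - N%:R * h j x).
split; split=> //.
- move=> [b|i] /=; first exact: w0.
  case: ifP => // ai; have := hsc lam nu kkt i.
  by move/eqP: (ai) => ->; rewrite addr0 mulr0 subr0.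
- move=> i; apply: definable_CkT => //; case: (unlift ord0 i) => [j|] //.
  by case: (act j); [exact: dsig|exact: definable_Ck_cst].
- move=> i; case: (unlift ord0 i) => [j|]; last first.
    by apply: wsos => // x b Ux; exact: (Ux (inl b)).
  case: ifP => aj; last exact: sum_of_squares0.
  apply: sum_of_squares_pos => // x Ux.
  by have := Ux (inr j); rewrite /= aj.
- move=> j; apply: definable_CkT => //.
  exact: (definable_CkB hD (definable_Ck_cst hD _ _ _)
    (definable_CkM hD (definable_Ck_cst hD _ _ _) (toC0 _ (toC _ (dh j))))).
move=> x Ux; rewrite unlift_none sumu.
have -> : \sum_(i < l) (match unlift ord0 (lift ord0 i) with
    | None => fun x => L x + N%:R * \sum_t u t x ^+ 2
    | Some i => if act i then fun x => lam i - N%:R * g i x else fun=> 0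
    end) x * g i x = \sum_(i | act i) lam i * g i x - N%:R * \sum_(i | act i) g i x ^+ 2.
  rewrite mulr_sumr -sumrB [RHS]big_mkcond; apply: eq_bigr => i _.
  by rewrite liftK; case: (act i); [ring|rewrite mul0r].
have -> : \sum_(j < m) (nu j - N%:R * h j x) * h j x =
    \sum_j nu j * h j x - N%:R * \sum_j h j x ^+ 2.
  by rewrite mulr_sumr -sumrB; apply: eq_bigr => j _; ring.
by rewrite /L /lagrangian -/act; ring.
Qed.
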